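(* Let $F^{\bullet}$ be a chain complex of finitely-generated free $2$-parameter persistence modules over $k=\mathbb{Z}_2$, together with an ordered basis for each $F^{n}$, and let $G^{\bullet}$ be the output of the algorithm multi-chunk applied to the input $F^{\bullet}$. Then, for every dimension $n\ge 0$ and every grade $\mathbf p\in\mathbb{Z}^2$, $$\delta_{\mathbf p}^n(F^{\bullet})=\gamma_{\mathbf p}^n(G^{\bullet}).$$
   Context: **Persistence modules.** Let $k=\mathbb{Z}_2$ and let $\mathbb{Z}^2$ carry the product partial order. A ($2$-parameter) persistence module is a functor $M:\mathbb{Z}^2\to \mathrm{Vec}_k$; homomorphisms are natural transformations. An element $v\in M_{\mathbf z}$ has grade $\mathrm{gr}(v)=\mathbf z$. For $\mathbf u\in\mathbb{Z}^2$, $E^{\mathbf u}$ is the module with $E^{\mathbf u}_{\mathbf z}=k$ if $\mathbf u\le \mathbf z$ and $0$ otherwise, with identity maps between nonzero spaces. A module is free if it is isomorphic to a direct sum of modules $E^{\mathbf u}$; a basis is a minimal set of homogeneous generators. A chain complex $F^\bullet$ of free persistence modules is a diagram $\cdots\xrightarrow{\partial^2}F^1\xrightarrow{\partial^1}F^0$ of free modules with $\partial^i\circ\partial^{i+1}=0$ (put $\partial^0=0$). **The quantities $\delta$ and $\gamma$.** Let $\bar F^\bullet$ be a chain complex of finitely generated free persistence modules and $\mathbf p=(p_x,p_y)\in\mathbb{Z}^2$. Let $\bar F^n_{<\mathbf p}$ be the colimit of the restriction of $\bar F^n$ to the subposet $\{\mathbf z\in\mathbb{Z}^2:\mathbf z<\mathbf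 p\}$ (i.e. $\mathbf z\le\mathbf p$, $\mathbf z\ne\mathbf p$). Equivalently, with $\mathbf p_0=(p_x-1,p_y-1)$, $\mathbf p_1=(p_x-1,p_y)$, $\mathbf p_2=(p_x,p_y-1)$, it is defined by the short exact sequence $0\to \bar F^n_{\mathbf p_0}\to \bar F^n_{\mathbf p_1}\oplus\bar F^n_{\mathbf p_2}\to\bar F^n_{<\mathbf p}\to 0$. With the induced boundary maps $\bar F^\bullet_{<\mathbf p}$ is a chain complex of vector spaces, included in $\bar F^\bullet_{\mathbf p}$. Let $\eta^n_{\mathbf p}:H^n(\bar F^\bullet_{<\mathbf p})\to H^n(\bar F^\bullet_{\mathbf p})$ be the map in $n$-th homology induced by the inclusion (homology in degree $-1$ is $0$). Define $$\delta^n_{\mathbf p}(\bar F^\bullet)=\dim\operatorname{Ker}\eta^{n-1}_{\mathbf p}+\dim\operatorname{Coker}\eta^n_{\mathbf p},\qquad \gamma^n_{\mathbf p}(\bar F^\bullet)=\dim\bar F^n_{\mathbf p}-\dim\bar F^n_{<\mathbf p}.$$ **Graded matrices.** The input $F^\bullet$ has only finitely many nonzero terms. Each $F^n$ has an ordered basis $B^n$ whose order is compatible with grades: if $\mathrm{gr}(g_1)<\mathrm{gr}(g_2)$ then $g_1$ precedes $g_2$. The boundary $\partial^n$ is represented by a graded matrix whose columns correspond to $B^n$, whose rows correspond to $B^{n-1}$ (in these orders), each row and column being annotated by the grade of its generator. The index $i(c)$ of a column $c$ is its position. The boundary of a column is the set of generators (row indices) with nonzero entry in it. The pivot of a nonzero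 column is its largest row index with nonzero entry. If the grade of the pivot equals the grade of the column, the pivot is called the local pivot of the column (and otherwise the column has no local pivot). Columns are identified with the corresponding generators. **The algorithm multi-chunk.** *Phase I (local reduction).* Process the matrices of $\partial^n$ in decreasing order of $n$. For a given $n$, traverse the columns in increasing index. If column $c$ is already labeled, do nothing. Otherwise, as long as $c$ has a local pivot and there is a column $c'$ with $i(c')<i(c)$ with the same local pivot as $c$, perform the column addition $c\leftarrow c+c'$. If at the end $c$ has no local pivot, label $c$ as global. Otherwise label $c$ as local negative and its local pivot $c''\in B^{n-1}$ as local positive. (All elements of $B^0$ not labeled local positive are global.) *Phase II (compression).* For each $n$ and each global column $c$ of the matrix of $\partial^n$: while the boundary of $c$ contains a local (positive or negative) generator, let $c'$ be the one of maximal index. If $c'$ is local negative, remove $c'$ from the boundary of $c$ (set the entry to $0$). If $c'$ is local positive, let $c''$ be the unique local negative $n$-column with local pivot $c'$, and perform $c\leftarrow c+c''$. *Phase III (removal).* In all matrices, remove all columns and all rows labeled local (positive or negative). The resulting matrices represent the boundary maps $\partial^n:G^n\to G^{n-1}$ of the output $G^\bullet$, where $G^n$ is the free module with basis $C^n\subseteq B^n$, the set of global generators, with their original grades. *)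

(* Defs.v *)
From HB Require Import structures.
From mathcomp Require Import all_boot all_order all_algebra.

Set Implicit Arguments.
Unset Strict Implicit.
Unset Printing Implicit Defensive.

Import Order.TTheory GRing.Theory Num.Theory.

Local Open Scope ring_scope.

Definition pair_lfun (K : fieldType) (U V W : vectType K)
  (f : 'Hom(U, V)) (g : 'Hom(U, W)) : 'Hom(U, (V * W)%type) :=
  linfun (fun u => (f u, g u)).

Lemma pair_lfunE (K : fieldType) (U V W : vectType K)
  (f : 'Hom(U, V)) (g : 'Hom(U, W)) (u : U) : pair_lfun f g u = (f u, g u).
Proof.
have lin : linear (fun u : U => (f u, g u)).
  by move=> a x y; rewrite !linearP.
pose h := GRing.isLinear.Build _ _ _ _ _ lin.
pose F : {linear U -> (V * W)%type} := HB.pack (fun u : U => (f u, g u)) h.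
exact: (lfunE F u).
Qed.

(** The quotient of [U] by a subspace [V] of [U], realized on the complement
    [U :\: V] of [V] in [U]; [quot_pi] is the projection, meaningful on [U]. *)
Definition quot (K : fieldType) (vT : vectType K) (U V : {vspace vT}) :
  vectType K := subvs_of (U :\: V).

Definition quot_repr (K : fieldType) (vT : vectType K) (U V : {vspace vT}) :
  'Hom(quot U V, vT) := linfun vsval.

Definition quot_pi (K : fieldType) (vT : vectType K) (U V : {vspace vT}) :
  'Hom(vT, quot U V) := (linfun (vsproj (U :\: V)) \o addv_pi1 U V)%VF.

(** The map induced by [f] when [f @: U <= U'] and [f @: V <= V']; see
    [quot_mapE]. *)
Definition quot_map (K : fieldType) (vT wT : vectType K)
  (U V : {vspace vT}) (U' V' : {vspace wT}) (f : 'Hom(vT, wT)) :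
  'Hom(quot U V, quot U' V') :=
  (quot_pi U' V' \o f \o quot_repr U V)%VF.

Lemma quot_reprK (K : fieldType) (vT : vectType K) (U V : {vspace vT})
  (x : quot U V) : quot_pi U V (quot_repr U V x) = x.
Proof.
rewrite /quot_pi /quot_repr comp_lfunE !lfunE /= /addv_pi1 daddv_pi_id.
- by rewrite vsvalK.
- exact: capv_diff.
- exact: subvsP.
Qed.

Lemma quot_pi_eq0 (K : fieldType) (vT : vectType K) (U V : {vspace vT})
  (v : vT) : (V <= U)%VS -> v \in U -> (quot_pi U V v == 0) = (v \in V).
Proof.
move=> sVU Uv; have dUV : ((U :\: V) :&: V = 0)%VS by rewrite capv_diff.
have eq0 : (quot_pi U V v == 0) = (addv_pi1 U V v == 0).
  rewrite /quot_pi comp_lfunE lfunE /= -(inj_eq val_inj) /= vsprojK //.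
  exact: memv_pi.
have UVv : v \in (U + V)%VS by rewrite (subvP (addvSl U V)).
rewrite eq0; apply/eqP/idP=> [pi0 | Vv].
  by rewrite -(addv_pi1_pi2 UVv) pi0 add0r memv_pi2.
have := daddv_pi_add dUV (subvP (addvSr (U :\: V) V) v Vv).
rewrite (daddv_pi_id _ Vv); last by rewrite capvC.
by move=> /(canRL (addrK v)); rewrite subrr.
Qed.

Lemma quot_mapE (K : fieldType) (vT wT : vectType K)
  (U V : {vspace vT}) (U' V' : {vspace wT}) (f : 'Hom(vT, wT)) (v : vT) :
    (V <= U)%VS -> (V' <= U')%VS -> (f @: U <= U')%VS -> (f @: V <= V')%VS ->
  v \in U -> quot_map U V U' V' f (quot_pi U V v) = quot_pi U' V' (f v).
Proof.
move=> sVU sVU' fU fV Uv.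
have UvP : quot_repr U V (quot_pi U V v) \in U.
  by rewrite lfunE (subvP (diffvSl U V)) // subvsP.
set w := quot_repr U V _ in UvP.
have wE : quot_pi U V w = quot_pi U V v by exact: quot_reprK.
have -> : quot_map U V U' V' f (quot_pi U V v) = quot_pi U' V' (f w).
  by rewrite [LHS]comp_lfunE comp_lfunE.
have Uwv : w - v \in U by rewrite rpredB.
have Vwv : w - v \in V.
  rewrite -(quot_pi_eq0 sVU Uwv).
  by apply/eqP; apply: etrans (linearB _ _ _) _; apply/eqP; rewrite subr_eq0; apply/eqP.
apply/eqP; rewrite -subr_eq0.
suff: quot_pi U' V' (f (w - v)) == 0.
  by move/eqP=> f0; apply/eqP; rewrite -{}[RHS]f0 !linearB.
rewrite quot_pi_eq0 //.
  by apply: (subvP fV); apply: memv_img.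
by apply: (subvP fU); apply: memv_img.
Qed.

Definition coker (K : fieldType) (vT wT : vectType K) (f : 'Hom(vT, wT)) :
  vectType K := quot fullv (limg f).

(** [vd n] is the boundary map from degree [n.+1] to degree [n]. *)
Record vseq := VSeq {
  vsp :> nat -> vectType 'F_2;
  vd : forall n, 'Hom(vsp n.+1, vsp n)
}.

Definition cycles (C : vseq) (n : nat) : {vspace C n} :=
  match n with
  | 0 => fullv
  | n'.+1 => lker (vd C n')
  end.

Definition boundaries (C : vseq) (n : nat) : {vspace C n} := limg (vd C n).

Definition homology (C : vseq) (n : nat) : vectType 'F_2 :=
  quot (cycles C n) (boundaries C n).

Definition homology_map (C C' : vseq) (f : forall n, 'Hom(C n, C' n))
  (n : nat) : 'Hom(homology C n, homology C' n) :=
  quot_map _ _ _ _ (f n).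

Definition grade := (int *p int)%type.

(** All spaces are finite dimensional, as is the case for finitely generated
    modules. *)
Record pmod := PMod {
  pm_space :> grade -> vectType 'F_2;
  pm_map : forall u z : grade, (u <= z)%O -> 'Hom(pm_space u, pm_space z);
  pm_map_id : forall u (h : (u <= u)%O), pm_map h = \1%VF;
  pm_map_comp : forall u z w (h1 : (u <= z)%O) (h2 : (z <= w)%O)
    (h3 : (u <= w)%O), (pm_map h2 \o pm_map h1)%VF = pm_map h3
}.

Definition pm_shift (M : pmod) (u z : grade) : 'Hom(M u, M z) :=
  match @idP (u <= z)%O with
  | ReflectT h => pm_map M h
  | ReflectF _ => 0
  end.

Record pmor (M N : pmod) := PMor {
  pm_app :> forall z : grade, 'Hom(M z, N z);
  pm_natural : forall u z (h : (u <= z)%O),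
    (pm_app z \o pm_map M h = pm_map N h \o pm_app u)%VF
}.

Definition pm_iso (M N : pmod) : Prop :=
  exists (f : pmor M N) (g : pmor N M),
    forall z, (g z \o f z = \1)%VF /\ (f z \o g z = \1)%VF.

(** [E^u], with [k] and [0] realized as the two subspaces of [k]. *)
Definition E_sub (u z : grade) : {vspace ('F_2)^o} :=
  if (u <= z)%O then fullv else 0%VS.

Lemma E_sub_le (u z w : grade) : (z <= w)%O -> (E_sub u z <= E_sub u w)%VS.
Proof.
rewrite /E_sub => zw; case: ifP => [uz|_]; last exact: sub0v.
by rewrite (le_trans uz zw).
Qed.

Definition E_space (u z : grade) : vectType 'F_2 := subvs_of (E_sub u z).

Definition E_map (u z w : grade) (_ : (z <= w)%O) :
  'Hom(E_space u z, E_space u w) :=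
  (linfun (vsproj _) \o linfun vsval)%VF.

Lemma E_map_id (u z : grade) (h : (z <= z)%O) : E_map u h = \1%VF.
Proof. by apply/lfunP=> v; rewrite comp_lfunE !lfunE /= vsvalK. Qed.

Lemma E_map_comp (u z w t : grade) (h1 : (z <= w)%O) (h2 : (w <= t)%O)
  (h3 : (z <= t)%O) : (E_map u h2 \o E_map u h1)%VF = E_map u h3.
Proof.
apply/lfunP=> v; rewrite !comp_lfunE !lfunE /= vsprojK //.
exact: subvP (E_sub_le u h1) _ (subvsP v).
Qed.

Definition E (u : grade) : pmod := PMod (@E_map_id u) (@E_map_comp u).

Definition zero_space (z : grade) : vectType 'F_2 := 'rV['F_2]_0.

Definition pm_zero : pmod :=
  @PMod zero_space (fun _ _ _ => \1%VF) (fun _ _ => erefl)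
    (fun _ _ _ _ _ _ => comp_lfun1l _).

Definition dsum_space (M N : pmod) (z : grade) : vectType 'F_2 :=
  (M z * N z)%type.

Definition dsum_map (M N : pmod) (u z : grade) (h : (u <= z)%O) :
  'Hom(dsum_space M N u, dsum_space M N z) :=
  pair_lfun (pm_map M h \o linfun fst) (pm_map N h \o linfun snd).

Lemma dsum_map_id (M N : pmod) (u : grade) (h : (u <= u)%O) :
  dsum_map M N h = \1%VF.
Proof.
apply/lfunP=> v; rewrite pair_lfunE !comp_lfunE !lfunE /= !pm_map_id !id_lfunE.
by case: v.
Qed.

Lemma dsum_map_comp (M N : pmod) (u z w : grade) (h1 : (u <= z)%O)
  (h2 : (z <= w)%O) (h3 : (u <= w)%O) :
  (dsum_map M N h2 \o dsum_map M N h1)%VF = dsum_map M N h3.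
Proof.
apply/lfunP=> v; rewrite comp_lfunE !pair_lfunE !comp_lfunE !lfunE /=.
by rewrite -(pm_map_comp M h1 h2 h3) -(pm_map_comp N h1 h2 h3) !comp_lfunE.
Qed.

Definition dsum (M N : pmod) : pmod :=
  PMod (@dsum_map_id M N) (@dsum_map_comp M N).

Definition fg_free (M : pmod) : Prop :=
  exists us : seq grade, pm_iso M (foldr (fun u N => dsum (E u) N) pm_zero us).

Section Bases.
Variables (M : pmod) (m : nat) (gr : 'I_m -> grade) (b : forall i, M (gr i)).

Definition generates (A : {set 'I_m}) : Prop :=
  forall z : grade, (\sum_(i in A) <[pm_shift M (gr i) z (b i)]> = fullv)%VS.

Definition is_basis : Prop :=
  generates setT /\ forall A, generates A -> A = setT.

End Bases.

(** [bd n] is the boundary map from degree [n.+1] to degree [n]. *)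
Record pmseq := PMSeq {
  term :> nat -> pmod;
  bd : forall n, pmor (term n.+1) (term n)
}.

Definition is_complex (X : pmseq) : Prop :=
  forall n z, (bd X n z \o bd X n.+1 z)%VF = 0.

Definition pm_is_zero (M : pmod) : Prop := forall z, \dim {: M z} = 0%N.

Definition at_grade (X : pmseq) (p : grade) : vseq :=
  VSeq (fun n => bd X n p).

Section Below.
Variable p : grade.

Definition below0 : grade := (p.1 - 1, p.2 - 1).
Definition below1 : grade := (p.1 - 1, p.2).
Definition below2 : grade := (p.1, p.2 - 1).

(** The colimit of [M] over [{z | z < p}], presented as the cokernel of
    [M below0 -> M below1 * M below2]. *)
Definition lt_rel (M : pmod) : {vspace (M below1 * M below2)%type} :=
  limg (pair_lfun (pm_shift M below0 below1) (- pm_shift M below0 below2)).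

Definition lt_space (M : pmod) : vectType 'F_2 := quot fullv (lt_rel M).

Definition lt_map (M N : pmod) (f : pmor M N) :
  'Hom(lt_space M, lt_space N) :=
  quot_map _ _ _ _
    (pair_lfun (f below1 \o linfun fst) (f below2 \o linfun snd)).

Definition lt_incl (M : pmod) : 'Hom(lt_space M, M p) :=
  (((pm_shift M below1 p \o linfun fst) + (pm_shift M below2 p \o linfun snd))
     \o quot_repr _ _)%VF.

Definition lt_grade (X : pmseq) : vseq := VSeq (fun n => lt_map (bd X n)).

Definition eta (X : pmseq) (n : nat) :
  'Hom(homology (lt_grade X) n, homology (at_grade X p) n) :=
  @homology_map (lt_grade X) (at_grade X p) (fun n => lt_incl (X n)) n.

Definition delta (X : pmseq) (n : nat) : nat :=
  ((if n is n'.+1 then \dim (lker (eta X n')) else 0)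
    + \dim {: coker (eta X n)})%N.

Definition gamma (X : pmseq) (n : nat) : int :=
  (\dim {: X n p})%:Z - (\dim {: lt_space (X n)})%:Z.

End Below.

(** [gm_mx n] has the generators of degree [n.+1] as columns and those of
    degree [n] as rows. *)
Record gmatrices := GMatrices {
  gm_size : nat -> nat;
  gm_grade : forall n, 'I_(gm_size n) -> grade;
  gm_mx : forall n, 'M['F_2]_(gm_size n, gm_size n.+1)
}.

Definition order_compatible (A : gmatrices) : Prop :=
  forall n (i j : 'I_(gm_size A n)),
    (gm_grade i < gm_grade j)%O -> (i < j)%N.

(** [A] consists of the graded matrices of the boundary maps of [X] with
    respect to some bases. *)
Definition represents (A : gmatrices) (X : pmseq) : Prop :=
  exists b : forall n (i : 'I_(gm_size A n)), X n (gm_grade i),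
    [/\ forall n, fg_free (X n),
        forall n, is_basis (b n),
        forall n i j, gm_mx A n i j != 0 -> (gm_grade i <= gm_grade j)%O
      & forall n j, bd X n _ (b n.+1 j) =
          \sum_i gm_mx A n i j *: pm_shift (X n) (gm_grade i) (gm_grade j) (b n i)].

(** Programs are relations between initial and final states; a [while] loop
    stops only when no further step is possible. *)
Inductive while (S : Type) (step : S -> S -> Prop) : S -> S -> Prop :=
| while_stop s : (forall s', ~ step s s') -> while step s s
| while_iter s s' s'' : step s s' -> while step s' s'' -> while step s s''.

Fixpoint foreach (T S : Type) (body : T -> S -> S -> Prop) (xs : seq T)
  (s s' : S) : Prop :=
  if xs is x :: xs' then exists2 s1, body x s s1 & foreach body xs' s1 s'
  else s' = s.

Inductive label := Global | LocalNegative | LocalPositive.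

Definition is_global (l : option label) : bool :=
  if l is Some Global then true else false.

Definition is_local (l : option label) : bool :=
  match l with
  | Some LocalNegative | Some LocalPositive => true
  | _ => false
  end.

Section MultiChunk.
Variables (m : nat -> nat) (gr : forall n, 'I_(m n) -> grade).

Definition matrices := forall n, 'M['F_2]_(m n, m n.+1).

Definition labelling := forall n, 'I_(m n) -> option label.

Record state := State { st_mx : matrices; st_label : labelling }.

Definition set_mx (D : matrices) n (B : 'M['F_2]_(m n, m n.+1)) : matrices :=
  @dfwith _ (fun n => 'M['F_2]_(m n, m n.+1)) D n B.

Definition set_label (L : labelling) n (i : 'I_(m n)) (l : label) : labelling :=
  @dfwith _ (fun n => 'I_(m n) -> option label) L n
    (fun j => if j == i then Some l else L n j).

Definition add_column (D : matrices) n (c c' : 'I_(m n.+1)) : matrices :=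
  set_mx D (\matrix_(i, j) if j == c then D n i c + D n i c' else D n i j).

Definition clear_entry (D : matrices) n (r : 'I_(m n)) (c : 'I_(m n.+1)) :
  matrices :=
  set_mx D (\matrix_(i, j) if (i == r) && (j == c) then 0 else D n i j).

Definition is_pivot (D : matrices) n (r : 'I_(m n)) (c : 'I_(m n.+1)) : bool :=
  (D n r c != 0) && [forall i, (D n i c != 0) ==> (i <= r)%N].

Definition is_local_pivot (D : matrices) n (r : 'I_(m n)) (c : 'I_(m n.+1)) :
  bool :=
  is_pivot D r c && (gr r == gr c).

Definition reduce_step n (c : 'I_(m n.+1)) (D D' : matrices) : Prop :=
  exists (r : 'I_(m n)) (c' : 'I_(m n.+1)),
    [/\ is_local_pivot D r c, (c' < c)%N, is_local_pivot D r c'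
      & D' = add_column D c c'].

Definition process_column n (c : 'I_(m n.+1)) (s s' : state) : Prop :=
  if st_label s c is Some _ then s' = s
  else exists2 D', while (reduce_step c) (st_mx s) D' &
    (exists2 r, is_local_pivot D' r c &
       s' = State D' (set_label (set_label (st_label s) c LocalNegative)
                                r LocalPositive))
    \/ ((forall r, ~~ is_local_pivot D' r c) /\
        s' = State D' (set_label (st_label s) c Global)).

(** In degree 0 the boundary map is zero, so every generator that is still
    unlabeled at the end becomes global. *)
Definition label_degree0 (s : state) : state :=
  State (st_mx s)
    (@dfwith _ (fun n => 'I_(m n) -> option label) (st_label s) 0
       (fun i => if st_label s i is Some l then Some l else Some Global)).

(** [N] bounds the degrees of the nonzero terms; the matrix with index [n]
    is that of the boundary map from degree [n.+1] to degree [n]. *)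
Definition phase1 (N : nat) (s s' : state) : Prop :=
  exists2 s1,
    foreach (fun n => foreach (@process_column n) (enum 'I_(m n.+1)))
      (rev (iota 0 N)) s s1
    & s' = label_degree0 s1.

Definition compress_step (L : labelling) n (c : 'I_(m n.+1))
  (D D' : matrices) : Prop :=
  exists c' : 'I_(m n),
    [/\ D n c' c != 0,
        is_local (L n c'),
        forall i, D n i c != 0 -> is_local (L n i) -> (i <= c')%N
      & (L n c' = Some LocalNegative /\ D' = clear_entry D c' c)
        \/ (L n c' = Some LocalPositive /\
            exists c'' : 'I_(m n.+1),
              [/\ L n.+1 c'' = Some LocalNegative, is_local_pivot D c' c''
                & D' = add_column D c c''])].

Definition phase2 (N : nat) (L : labelling) (D D' : matrices) : Prop :=
  foreach
    (fun n => foreach (fun c => while (@compress_step L n c))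
                [seq c <- enum 'I_(m n.+1) | is_global (L n.+1 c)])
    (iota 0 N) D D'.

Definition global_gens (L : labelling) n : {set 'I_(m n)} :=
  [set i | is_global (L n i)].

(** [enum_val] enumerates [global_gens L n] in increasing order. *)
Definition phase3 (L : labelling) (D : matrices) : gmatrices :=
  @GMatrices (fun n => #|global_gens L n|)
    (fun n i => gr (enum_val i))
    (fun n => mxsub enum_val enum_val (D n)).

End MultiChunk.

(** A relation, because the choice of [c'] in [reduce_step] is not determined. *)
Definition multi_chunk (N : nat) (A A' : gmatrices) : Prop :=
  exists (s : state (gm_size A)) (D : matrices (gm_size A)),
    [/\ phase1 (@gm_grade A) N (State (gm_mx A) (fun _ _ => None)) s,
        phase2 (@gm_grade A) N (st_label s) (st_mx s) D
      & A' = phase3 (@gm_grade A) (st_label s) D].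

(* Main.v *)
(** The basis elements of grade [p] form a basis of the quotient of [F_p] by the
    image of [F_{<p}].  The long exact homology sequence of this pair therefore
    gives [delta^n_p(F) = a_n - r_n - r_{n-1}], where [a_n] is the number of
    generators of degree [n] and grade [p], and [r_n] is the rank of the
    submatrix of the boundary matrix from degree [n+1] to degree [n] on the rows
    and columns of grade [p].  Phase I is a Gaussian elimination of these
    submatrices: [r_n] counts the local negative columns of grade [p], hence also
    their pivots, the local positive rows of grade [p].  The columns skipped
    because they are local positive do not matter: such a generator is the local
    pivot of a reduced column of the next matrix, so its own local column depends
    on those of smaller index, as [d o d = 0].  So exactly [delta^n_p(F)]
    generators of degree [n] and grade [p] remain global, which is
    [gamma^n_p(G)].  Phase II changes neither labels nor grades. *)

Require Import Defs.
From HB Require Import structures.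
From mathcomp Require Import all_boot all_order all_algebra.
From mathcomp Require Import zify ring.

Set Implicit Arguments.
Unset Strict Implicit.
Unset Printing Implicit Defensive.

Import Order.TTheory GRing.Theory Num.Theory.
Local Open Scope ring_scope.

(** * Dimensions of quotient maps *)

Lemma dim_sumv_lines (K : fieldType) (vT : vectType K) (I : finType)
    (A : {set I}) (v : I -> vT) :
  (forall a : I -> K, \sum_(i in A) a i *: v i = 0 ->
     forall i, i \in A -> a i = 0) ->
  \dim (\sum_(i in A) <[v i]>)%VS = #|A|.
Proof.
move=> indep.
have dir : directv (\sum_(i in A) <[v i]>).
  apply/directv_sum_independent => us usP us0 i Ai.
  have /all_tag[a aP] j : {a | j \in A -> us j = a *: v j}.
    case: (boolP (j \in A)) => [Aj|_]; last by exists 0.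
    by have /vlineP/sig_eqW[a ->] := usP j Aj; exists a.
  rewrite aP // [a i]indep ?scale0r //; apply: etrans us0.
  by apply: eq_bigr => j /aP->.
rewrite (directvP dir) /= -sum1_card; apply: eq_bigr => i Ai.
rewrite dim_vline; case: eqP => // vi0.
have := indep (fun j => (j == i)%:R); rewrite (bigD1 i) //= eqxx scale1r vi0 add0r.
rewrite big1 => [|j /andP[_ /negPf->]]; last by rewrite scale0r.
by move=> /(_ erefl i Ai)/eqP; rewrite eqxx oner_eq0.
Qed.

Section QuotientDim.
Variable K : fieldType.

Lemma dim_quot (vT : vectType K) (U V : {vspace vT}) :
  (V <= U)%VS -> (\dim {: quot U V} + \dim V)%N = \dim U.
Proof.
move=> sVU; rewrite dimvf -[X in (X + _)%N]/(\dim (U :\: V)) addnC.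
by rewrite -{1}(capv_idPr sVU) dimv_cap_compl.
Qed.

Lemma limg_quot_repr (vT : vectType K) (U V : {vspace vT}) :
  limg (quot_repr U V) = (U :\: V)%VS.
Proof.
apply/vspaceP=> v; apply/memv_imgP/idP => [[x _ ->]|Dv].
  by rewrite /quot_repr lfunE /= subvsP.
exists (vsproj (U :\: V) v); first exact: memvf.
by rewrite /quot_repr lfunE /= vsprojK.
Qed.

(** Rank-nullity: on [X] the projection has kernel [X :&: V]. Dimensions are added, here and below,
    because subtraction of naturals truncates. *)
Lemma dim_quot_pi_img (vT : vectType K) (U V X : {vspace vT}) :
  (V <= U)%VS -> (X <= U)%VS ->
  (\dim (quot_pi U V @: X) + \dim V)%N = \dim (X + V).
Proof.
move=> sVU sXU; apply/eqP; rewrite -(eqn_add2r (\dim (X :&: V))).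
rewrite dimv_sum_cap addnAC eqn_add2r -(limg_ker_dim (quot_pi U V) X) addnC.
rewrite eqn_add2r; apply/eqP; congr (\dim _); apply/vspaceP=> v.
rewrite !memv_cap memv_ker; apply: andb_id2l => Xv.
by rewrite quot_pi_eq0 ?(subvP sXU).
Qed.

Variables (vT wT : vectType K) (U V : {vspace vT}) (U' V' : {vspace wT}).
Variable f : 'Hom(vT, wT).
Hypotheses (sVU : (V <= U)%VS) (sVU' : (V' <= U')%VS).
Hypotheses (fU : (f @: U <= U')%VS) (fV : (f @: V <= V')%VS).

Lemma dim_limg_quot_map :
  (\dim (limg (quot_map U V U' V' f)) + \dim V')%N = \dim (f @: U + V').
Proof.
rewrite /quot_map limg_comp limg_quot_repr limg_comp dim_quot_pi_img //; last first.
  by apply: subv_trans fU; apply: limgS; apply: diffvSl.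
(* [U] is the complement [U :\: V] plus [U :&: V], and the image of the latter is absorbed by
   [V']. *)
congr (\dim _); rewrite -{2}(addv_diff_cap U V) limgD -addvA.
by congr (_ + _)%VS; apply/esym/addv_idPr/(subv_trans _ fV)/limgS/capvSr.
Qed.

Lemma dim_lker_quot_map :
  (\dim (lker (quot_map U V U' V' f)) + \dim (f @: U + V') + \dim V)%N
    = (\dim U + \dim V')%N.
Proof.
have := limg_ker_dim (quot_map U V U' V' f) fullv; rewrite capfv.
have := dim_limg_quot_map; have := dim_quot sVU; lia.
Qed.

Lemma dim_coker_quot_map :
  (\dim {: coker (quot_map U V U' V' f)} + \dim (f @: U + V'))%N = \dim U'.
Proof.
have := dim_quot (subvf (limg (quot_map U V U' V' f))).
have := dim_limg_quot_map; have := dim_quot sVU'; rewrite /coker; lia.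
Qed.

End QuotientDim.

(** * Persistence modules *)

Section Shift.
Variable M : pmod.

Lemma pm_shiftE u z (h : (u <= z)%O) : pm_shift M u z = pm_map M h.
Proof.
rewrite /pm_shift; case: {-}_ / idP => [h'|/(_ h)//].
by rewrite (bool_irrelevance h' h).
Qed.

Lemma pm_shift_id u : pm_shift M u u = \1%VF.
Proof. by rewrite (pm_shiftE (lexx u)) pm_map_id. Qed.

Lemma pm_shift_out u z : ~~ (u <= z)%O -> pm_shift M u z = 0.
Proof. by move=> /negP nh; rewrite /pm_shift; case: {-}_ / idP. Qed.

Lemma pm_shift_comp u z w (x : M u) : (u <= z)%O -> (z <= w)%O ->
  pm_shift M z w (pm_shift M u z x) = pm_shift M u w x.
Proof.
move=> h1 h2; rewrite !(pm_shiftE h1, pm_shiftE h2) (pm_shiftE (le_trans h1 h2)).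
by rewrite -(pm_map_comp M h1 h2) comp_lfunE.
Qed.

End Shift.

Lemma pm_shift_natural (M N : pmod) (f : pmor M N) u z (x : M u) :
  f z (pm_shift M u z x) = pm_shift N u z (f u x).
Proof.
case: (boolP (u <= z)%O) => h; last by rewrite !pm_shift_out // !lfunE linear0.
by rewrite !(pm_shiftE _ h) -comp_lfunE pm_natural comp_lfunE.
Qed.

Section Grades.
Variable p : grade.

Lemma below01 : (below0 p <= below1 p)%O.
Proof. by rewrite leEprod /=; lia. Qed.

Lemma below02 : (below0 p <= below2 p)%O.
Proof. by rewrite leEprod /=; lia. Qed.

Lemma below1_le : (below1 p <= p)%O.
Proof. by rewrite leEprod /=; lia. Qed.

Lemma below2_le : (below2 p <= p)%O.
Proof. by rewrite leEprod /=; lia. Qed.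

(** Grades are integral, so a strict inequality leaves a whole unit of room in at least one
    coordinate. *)
Lemma lt_below u : (u < p)%O = (u <= below1 p)%O || (u <= below2 p)%O.
Proof.
case: p u => [p1 p2] [u1 u2]; rewrite lt_neqAle !leEprod /= -pair_eqE /pair_eq /=.
lia.
Qed.

Lemma le_below0 u : (u <= below0 p)%O = (u <= below1 p)%O && (u <= below2 p)%O.
Proof. by case: p u => [p1 p2] [u1 u2]; rewrite !leEprod /=; lia. Qed.

End Grades.

(** Exactness in the middle of [M (below0 p) -> M (below1 p) * M (below2 p) -> M p], which makes the
    colimit below [p] embed in [M p]. It fails for general modules and is what freeness provides. *)
Definition lt_exact (M : pmod) : Prop :=
  forall p (x : M (below1 p)) (y : M (below2 p)),
    pm_shift M (below1 p) p x + pm_shift M (below2 p) p y = 0 ->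
  exists w : M (below0 p), x = pm_shift M (below0 p) (below1 p) w
    /\ y = - pm_shift M (below0 p) (below2 p) w.

Lemma lt_exact_iso (M N : pmod) : pm_iso M N -> lt_exact N -> lt_exact M.
Proof.
move=> [f [g fg]] exN p x y xy0.
have gfK z (v : M z) : g z (f z v) = v.
  by rewrite -comp_lfunE (fg z).1 id_lfunE.
have := congr1 (f p) xy0; rewrite linearD linear0 /= !pm_shift_natural.
move=> /exN[w [xw yw]]; exists (g _ w).
split; first by rewrite -pm_shift_natural -xw gfK.
by rewrite -pm_shift_natural -[LHS]gfK yw linearN.
Qed.

Lemma lt_exact0 : lt_exact pm_zero.
Proof.
move=> p x y _; exists 0; rewrite !linear0.
have eq0 (v w : 'rV['F_2]_0) : v = w by apply/rowP; case.
by split; apply: eq0.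
Qed.

Lemma dsum_shiftE (M N : pmod) u z (x : dsum M N u) :
  pm_shift (dsum M N) u z x = (pm_shift M u z x.1, pm_shift N u z x.2).
Proof.
case: (boolP (u <= z)%O) => h; last by rewrite !pm_shift_out // !lfunE.
by rewrite !(pm_shiftE _ h) pair_lfunE !comp_lfunE !lfunE.
Qed.

Lemma lt_exact_dsum (M N : pmod) :
  lt_exact M -> lt_exact N -> lt_exact (dsum M N).
Proof.
move=> exM exN p [x1 x2] [y1 y2]; rewrite !dsum_shiftE => -[].
move=> /exM[w1 [-> ->]] /exN[w2 [-> ->]].
by exists (w1, w2); rewrite !dsum_shiftE.
Qed.

Lemma E_shift_val u z w (x : E u z) : (z <= w)%O ->
  vsval (pm_shift (E u) z w x) = vsval x.
Proof.
move=> h; rewrite (pm_shiftE _ h) comp_lfunE !lfunE /= vsprojK //.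
exact: subvP (E_sub_le u h) _ (subvsP x).
Qed.

Lemma E_out u z (x : E u z) : ~~ (u <= z)%O -> x = 0.
Proof.
move=> /negPf h; apply: val_inj => /=; apply/eqP.
have E0 : E_sub u z = 0%VS by rewrite /E_sub h.
by rewrite -memv0; have := subvsP x; rewrite [X in _ \in pred_of_vspace X -> _]E0.
Qed.

(** Either [u] lies below [below0 p] and all four spaces are copies of [k], or by [le_below0] one of
    the two middle spaces vanishes, and then the other component is zero because it maps injectively
    to grade [p]. *)
Lemma lt_exact_E u : lt_exact (E u).
Proof.
move=> p x y xy0.
have xyV : vsval x + vsval y = 0.
  have := congr1 vsval xy0.
  by rewrite linearD /= !E_shift_val ?below1_le ?below2_le.
case: (boolP (u <= below0 p)%O) => [up0|].
  have xP : vsval x \in E_sub u (below0 p) by rewrite /E_sub up0 memvf.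
  exists (vsproj _ (vsval x)); split; apply: val_inj.
    by rewrite /= E_shift_val ?below01 // vsprojK.
  rewrite [RHS](linearN vsval) /= E_shift_val ?below02 // vsprojK //.
  by apply/eqP; rewrite -addr_eq0 addrC xyV.
rewrite le_below0 negb_and => /orP[]/E_out out; exists 0; rewrite !linear0.
  have x0 := out x; split=> //; apply: val_inj => /=.
  by move: xyV; rewrite x0 add0r.
have y0 := out y; split=> //; apply: val_inj => /=.
by move: xyV; rewrite y0 addr0.
Qed.

Lemma fg_free_lt_exact (M : pmod) : fg_free M -> lt_exact M.
Proof.
move=> [us /lt_exact_iso]; apply; elim: us => [|u us IH].
  exact: lt_exact0.
by apply: lt_exact_dsum IH; apply: lt_exact_E.
Qed.

(** * Homology below a grade *)

Lemma quot_repr_pi_sub (K : fieldType) (vT : vectType K) (U V : {vspace vT}) v :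
  (V <= U)%VS -> v \in U -> quot_repr U V (quot_pi U V v) - v \in V.
Proof.
move=> sVU Uv; have Ur : quot_repr U V (quot_pi U V v) \in U.
  by rewrite /quot_repr lfunE (subvP (diffvSl U V)) // subvsP.
rewrite -(quot_pi_eq0 sVU) ?rpredB //; apply/eqP.
apply: etrans (linearB _ _ _) _; apply/eqP; rewrite subr_eq0; apply/eqP.
exact: quot_reprK.
Qed.

Section Below.
Variables (p : grade) (M : pmod).

Definition below_sum : 'Hom((M (below1 p) * M (below2 p))%type, M p) :=
  ((pm_shift M (below1 p) p \o linfun fst)
   + (pm_shift M (below2 p) p \o linfun snd))%VF.

Lemma below_sumE v :
  below_sum v = pm_shift M (below1 p) p v.1 + pm_shift M (below2 p) p v.2.
Proof. by rewrite lfunE /= !comp_lfunE !lfunE. Qed.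

Lemma below_sum_rel v : v \in lt_rel p M -> below_sum v = 0.
Proof.
move=> /memv_imgP[w _ ->]; rewrite below_sumE pair_lfunE /= opp_lfunE linearN /=.
by rewrite !pm_shift_comp ?below01 ?below02 ?below1_le ?below2_le // subrr.
Qed.

Lemma lt_incl_pi v : lt_incl p M (quot_pi fullv (lt_rel p M) v) = below_sum v.
Proof.
rewrite /lt_incl comp_lfunE -/below_sum; apply/eqP.
rewrite -subr_eq0 -linearB; apply/eqP/below_sum_rel.
exact: quot_repr_pi_sub (subvf _) (memvf _).
Qed.

Lemma limg_lt_incl :
  limg (lt_incl p M)
    = (limg (pm_shift M (below1 p) p) + limg (pm_shift M (below2 p) p))%VS.
Proof.
apply/vspaceP=> v; apply/memv_imgP/memv_addP => [[x _ ->]|].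
  rewrite -(quot_reprK x) lt_incl_pi below_sumE.
  by do 2![eexists; first by apply: memv_img; apply: memvf].
move=> [_ /memv_imgP[x _ ->] [_ /memv_imgP[y _ ->] ->]].
exists (quot_pi _ _ (x, y)); first exact: memvf.
by rewrite lt_incl_pi below_sumE.
Qed.

(** A class killed in [M p] is represented by a pair with zero sum, and [lt_exact] exhibits this
    pair as one of the relations divided out. *)
Lemma lker_lt_incl : lt_exact M -> lker (lt_incl p M) == 0%VS.
Proof.
move=> exM; rewrite -subv0; apply/subvP=> x; rewrite memv_ker memv0 => /eqP.
rewrite -(quot_reprK x) lt_incl_pi below_sumE => /exM[w [xw yw]].
rewrite quot_pi_eq0 ?subvf ?memvf //; apply/memv_imgP; exists w; first exact: memvf.
by rewrite pair_lfunE opp_lfunE -xw -yw; case: (quot_repr _ _ _).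
Qed.

End Below.

Lemma dim_limg_lt_incl p (M : pmod) : lt_exact M ->
  \dim (limg (lt_incl p M)) = \dim {: lt_space p M}.
Proof.
move=> exM; apply: limg_dim_eq; have /eqP-> := lker_lt_incl p exM.
exact: capv0.
Qed.

Lemma lt_incl_natural p (M N : pmod) (f : pmor M N) x :
  lt_incl p N (lt_map p f x) = f p (lt_incl p M x).
Proof.
set g := pair_lfun (f (below1 p) \o linfun fst)%VF (f (below2 p) \o linfun snd)%VF.
have -> : lt_map p f x = quot_pi fullv (lt_rel p N) (g (quot_repr _ _ x)).
  by rewrite /lt_map /quot_map 2!comp_lfunE.
rewrite lt_incl_pi /g.
rewrite -{2}(quot_reprK x) lt_incl_pi !below_sumE pair_lfunE !comp_lfunE !lfunE /=.
by rewrite [RHS]linearD /= !pm_shift_natural.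
Qed.

Section DeltaDim.
Variables (X : pmseq) (p : grade).
Hypotheses (cX : is_complex X) (exX : forall n, lt_exact (X n)).

Let rad n := limg (lt_incl p (X n)).
(** The inclusion from right to left rests on injectivity of [lt_incl] one degree lower: a boundary
    that vanishes at [p] already vanishes below [p]. *)
Lemma rad_cycles n :
  (lt_incl p (X n) @: cycles (lt_grade p X) n
    = rad n :&: cycles (at_grade X p) n)%VS.
Proof.
case: n => [|n] /=; first by rewrite capvf.
apply/vspaceP=> v; apply/memv_imgP/memv_capP => [[x xc ->]|[/memv_imgP[x _ ->] xc]].
  rewrite memv_img ?memvf //; split=> //; move: xc; rewrite !memv_ker.
  by move=> /eqP x0; rewrite -lt_incl_natural x0 linear0.
exists x => //; move: xc; rewrite !memv_ker -lt_incl_natural.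
have /lker0P inj := lker_lt_incl p (@exX n).
by rewrite -[X in _ == X -> _](linear0 (lt_incl p (X n))) (inj_eq inj).
Qed.

Let C := at_grade X p.
Let C' := lt_grade p X.


Lemma boundaries_cycles n : (boundaries C n <= cycles C n)%VS.
Proof.
case: n => [|n]; first exact: subvf.
apply/subvP=> _ /memv_imgP[x _ ->].
by rewrite memv_ker /= -comp_lfunE cX zero_lfunE.
Qed.

Lemma lt_img_boundaries n :
  (lt_incl p (X n) @: boundaries C' n <= boundaries C n)%VS.
Proof.
apply/subvP=> _ /memv_imgP[_ /memv_imgP[x _ ->] ->].
by rewrite lt_incl_natural memv_img ?memvf.
Qed.

(** As [lt_incl] is injective, the inclusion can be checked after mapping to grade [p], where it
    follows from the complex condition on [X]. *)
Lemma lt_boundaries_cycles n : (boundaries C' n <= cycles C' n)%VS.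
Proof.
rewrite -(limg_ker0 _ _ (lker_lt_incl p (@exX n))) rad_cycles subv_cap.
by rewrite limgS ?subvf // (subv_trans (lt_img_boundaries n)) ?boundaries_cycles.
Qed.

Lemma lt_img_cycles n : (lt_incl p (X n) @: cycles C' n <= cycles C n)%VS.
Proof. by rewrite rad_cycles capvSr. Qed.

(** The dimension formula for a sum and an intersection; boundaries are cycles, so intersecting
    [rad n] with the cycles first changes nothing. *)
Lemma dim_cap_rad_boundaries n :
  (\dim (lt_incl p (X n) @: cycles C' n + boundaries C n)
    + \dim (rad n :&: boundaries C n) = \dim (cycles C' n) + \dim (boundaries C n))%N.
Proof.
rewrite -(limg_dim_eq (f := lt_incl p (X n)) (U := cycles C' n)).
  rewrite -[RHS]dimv_sum_cap rad_cycles; congr (_ + \dim _)%N.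
  by rewrite -capvA (capv_idPr (boundaries_cycles n)).
by have /eqP-> := lker_lt_incl p (@exX n); exact: capv0.
Qed.

(** [r n] is the rank of the boundary map modulo lower grades. It enters the counts of the kernel
    and of the cokernel of [eta]; rank-nullity for the boundary maps at [p] and below [p] then
    eliminates the dimensions of cycles and boundaries. *)
Lemma delta_rank (r : nat -> nat) :
  (forall n, \dim (rad n + boundaries C n) = \dim (rad n) + r n)%N ->
  forall n, (delta p X n + r n + (if n is n'.+1 then r n' else 0)
    = \dim {: X n p} - \dim (rad n))%N.
Proof.
move=> rE n.
(* This makes the truncated subtraction in the conclusion a genuine one. *)
have leR k : (\dim (rad k) <= \dim {: X k p})%N by apply: dimvS; apply: subvf.
have capE k := dimv_sum_cap (rad k) (boundaries C k).
have cokE k : (\dim {: coker (Defs.eta p X k)} + \dim (cycles C' k) + r k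
    = \dim (cycles C k))%N.
  have arith (a R' cap B s Z ZV c : nat) : (a = R' + r k -> a + cap = R' + B ->
    s + cap = Z + B -> c + s = ZV -> c + Z + r k = ZV)%N by lia.
  apply: arith (rE k) (capE k) (dim_cap_rad_boundaries k) _.
  exact: dim_coker_quot_map (lt_boundaries_cycles k) (boundaries_cycles k)
    (lt_img_cycles k) (lt_img_boundaries k).
have kerE k : (\dim (lker (Defs.eta p X k)) + \dim (boundaries C' k) + r k
    = \dim (boundaries C k))%N.
  have arith (a R' cap B s Z B' c : nat) : (a = R' + r k -> a + cap = R' + B ->
    s + cap = Z + B -> c + s + B' = Z + B -> c + B' + r k = B)%N by lia.
  apply: arith (rE k) (capE k) (dim_cap_rad_boundaries k) _.
  exact: dim_lker_quot_map (lt_boundaries_cycles k) (boundaries_cycles k)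
    (lt_img_cycles k) (lt_img_boundaries k).
have := cokE n; have := leR n; have := dim_limg_lt_incl p (@exX n).
case: n => [|n].
  have arith (c r0 z ra v : nat) : (ra = z -> ra <= v -> c + z + r0 = v ->
    0 + c + r0 + 0 = v - ra)%N by lia.
  exact: arith.
have kZ := limg_ker_dim (vd C n) fullv; have kZ' := limg_ker_dim (vd C' n) fullv.
rewrite !capfv in kZ kZ'.
have arith (c k r0 r1 z z' b b' ra w v : nat) : (c + b' + r0 = b -> z + b = v ->
  z' + b' = w ->
  ra = w -> ra <= v -> k + z' + r1 = z -> c + k + r1 + r0 = v - ra)%N by lia.
exact: arith (kerE n) kZ kZ'.
Qed.

End DeltaDim.

(** * Bases modulo lower grades *)

Lemma memv_sum_line (K : fieldType) (vT : vectType K) (I : finType)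
    (P : pred I) (v : I -> vT) i :
  P i -> v i \in (\sum_(j | P j) <[v j]>)%VS.
Proof. by move=> Pi; rewrite memvE (sumv_sup i). Qed.

Section Generators.
Variables (M : pmod) (m : nat) (gr : 'I_m -> grade) (b : forall i, M (gr i)).
Hypothesis basis_b : is_basis b.
Variable p : grade.

Let e i := pm_shift M (gr i) p (b i).
Let rad := limg (lt_incl p M).

Lemma gen_in_rad i : gr i != p -> e i \in rad.
Proof.
move=> ip; rewrite /rad limg_lt_incl.
case: (boolP (gr i <= p)%O) => [le_ip|]; last first.
  by move=> /pm_shift_out e0; rewrite /e e0 zero_lfunE mem0v.
have: (gr i < p)%O by rewrite lt_neqAle ip.
rewrite lt_below => /orP[] h.
  apply: (subvP (addvSl _ _)).
  by rewrite /e -(pm_shift_comp _ h (below1_le p)) memv_img ?memvf.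
apply: (subvP (addvSr _ _)).
by rewrite /e -(pm_shift_comp _ h (below2_le p)) memv_img ?memvf.
Qed.

Lemma limg_shift_sub z : (z < p)%O ->
  (limg (pm_shift M z p) <= \sum_(i | gr i != p) <[e i]>)%VS.
Proof.
move=> zp; rewrite -(basis_b.1 z) limg_sum.
apply/subv_sumP => i _; rewrite limg_line.
case: (boolP (gr i <= z)%O) => [iz|]; last first.
  by move=> /pm_shift_out->; rewrite zero_lfunE linear0 -memvE mem0v.
rewrite pm_shift_comp ?(ltW zp) //.
have ip : gr i != p by rewrite lt_eqF // (le_lt_trans iz).
by rewrite -memvE memv_sum_line.
Qed.

Lemma rad_sub : (rad <= \sum_(i | gr i != p) <[e i]>)%VS.
Proof.
by rewrite /rad limg_lt_incl subv_add !limg_shift_sub // lt_below lexx ?orbT.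
Qed.

(* A generator of grade [p] lying in the span of the others could be removed. *)
Lemma gens_indep_mod_rad (a : 'I_m -> 'F_2) :
  \sum_(i | gr i == p) a i *: e i \in rad -> forall i, gr i = p -> a i = 0.
Proof.
move=> sum_rad i ip; apply/eqP/negPn/negP => ai0.
(* Shown first at grade [p], which is [gr i], and then carried to [z] by the shift. *)
have others z : pm_shift M (gr i) z (b i)
    \in (\sum_(j in ~: [set i]) <[pm_shift M (gr j) z (b j)]>)%VS.
  have: e i \in (\sum_(j in ~: [set i]) <[e j]>)%VS.
    have sub : (rad <= \sum_(j in ~: [set i]) <[e j]>)%VS.
      apply: subv_trans rad_sub _; apply/subv_sumP => j jp.
      rewrite -memvE memv_sum_line // !inE; apply: contraNneq jp => ->.
      by rewrite ip.
    move/(subvP sub): sum_rad; rewrite (bigD1 i) ?ip //= rpredDr; last first.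
      apply: memv_suml => j /andP[_ ji]; rewrite rpredZ //.
      by rewrite memv_sum_line ?inE.
    by rewrite rpredZeq (negPf ai0).
  rewrite {}/e; case: p / ip; rewrite pm_shift_id id_lfunE => bi.
  have := memv_img (pm_shift M (gr i) z) bi; rewrite limg_sum.
  apply/subvP/subv_sumP => j ji; rewrite limg_line -memvE.
  case: (boolP (gr i <= z)%O) => [iz|/pm_shift_out->]; last first.
    by rewrite zero_lfunE mem0v.
  case: (boolP (gr j <= gr i)%O) => [le_ji|/pm_shift_out->]; last first.
    by rewrite zero_lfunE linear0 mem0v.
  rewrite pm_shift_comp //.
  by rewrite memv_sum_line.
have/setP/(_ i) : ~: [set i] = setT.
  apply: basis_b.2 => z; apply/eqP; rewrite eqEsubv subvf /= -(basis_b.1 z).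
  apply/subv_sumP => j _; rewrite -memvE; have [->|ji] := eqVneq j i.
    exact: others.
  by rewrite memv_sum_line ?inE.
by rewrite !inE eqxx.
Qed.

Lemma rad_gens_full : (rad + \sum_(i | gr i == p) <[e i]>)%VS = fullv.
Proof.
apply/eqP; rewrite eqEsubv subvf -(basis_b.1 p); apply/subv_sumP => i _.
rewrite -memvE; have [ip|ip] := eqVneq (gr i) p.
  apply: (subvP (addvSr _ _)).
  by rewrite memv_sum_line ?ip.
by apply: (subvP (addvSl _ _)); apply: gen_in_rad.
Qed.

Let s : 'Hom('rV['F_2]_m, M p) := linfun (fun x : 'rV_m => \sum_i x 0 i *: e i).

Lemma gens_combE (x : 'rV['F_2]_m) : s x = \sum_i x 0 i *: e i.
Proof.
have lin : linear (fun x : 'rV['F_2]_m => \sum_i x 0 i *: e i).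
  move=> a y z; rewrite scaler_sumr -big_split; apply: eq_bigr => i _ /=.
  by rewrite !mxE scalerDl scalerA.
pose h := GRing.isLinear.Build _ _ _ _ _ lin.
pose F : {linear 'rV['F_2]_m -> M p} :=
  HB.pack (fun x : 'rV['F_2]_m => \sum_i x 0 i *: e i) h.
exact: (lfunE F x).
Qed.

(* [s] identifies the vectors supported on generators of grade [p] with a
   complement of [rad]. *)
Lemma dim_rad_add (T : {vspace 'rV['F_2]_m}) :
  (forall x, x \in T -> forall i, gr i != p -> x 0 i = 0) ->
  \dim (rad + s @: T) = (\dim rad + \dim T)%N.
Proof.
move=> Tp.
have inj x : x \in T -> s x \in rad -> x = 0.
  move=> Tx; rewrite gens_combE (bigID (fun i => gr i == p)) /=.
  rewrite addrC [X in X + _]big1 ?add0r; last by move=> i /Tp-> //; rewrite scale0r.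
  move=> /gens_indep_mod_rad x0; apply/rowP=> i; rewrite mxE.
  by have [/x0|/Tp->] := eqVneq (gr i) p.
have sT : \dim (s @: T) = \dim T.
  apply: limg_dim_eq; apply/eqP; rewrite -subv0; apply/subvP=> x /memv_capP[Tx].
  by rewrite memv_ker memv0 => /eqP sx0; rewrite (inj x) // sx0 mem0v.
rewrite dimv_disjoint_sum ?sT //; apply/eqP; rewrite -subv0; apply/subvP.
move=> y /memv_capP[ry /memv_imgP[x Tx yE]]; move: ry; rewrite yE.
by move=> /(inj _ Tx)->; rewrite linear0 mem0v.
Qed.

Lemma dim_gens : \dim {: M p} = (\dim rad + #|[set i | gr i == p]|)%N.
Proof.
rewrite -rad_gens_full.
pose T := (\sum_(i in [set i | gr i == p]) <[delta_mx 0%R i : 'rV['F_2]_m]>)%VS.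
have -> : (\sum_(i | gr i == p) <[e i]>)%VS = (s @: T)%VS.
  rewrite limg_sum; apply: eq_big => [i|i _]; first by rewrite inE.
  rewrite limg_line gens_combE (bigD1 i) //= big1 ?addr0 => [|j /negPf ji].
    by rewrite mxE !eqxx scale1r.
  by rewrite mxE ji andbF scale0r.
rewrite dim_rad_add; first congr (_ + _)%N.
  apply: dim_sumv_lines => a a0 i Ai; have := congr1 (fun v : 'rV_m => v 0 i) a0.
  rewrite summxE (bigD1 i) //= big1 ?addr0 => [|j /andP[_ /negPf ji]].
    by rewrite !mxE !eqxx mulr1.
  by rewrite !mxE eq_sym ji andbF mulr0.
move=> x /memv_sumP[y yP ->] i ip; rewrite summxE big1 // => j jA.
have /vlineP[c ->] := yP j jA; rewrite !mxE.
have [ij|] := eqVneq i j; last by rewrite andbF mulr0.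
by move: jA ip; rewrite -ij inE => ->.
Qed.

End Generators.

Lemma dim_gens_lt (M : pmod) m (gr : 'I_m -> grade) (b : forall i, M (gr i)) p :
  is_basis b -> lt_exact M ->
  \dim {: M p} = (\dim {: lt_space p M} + #|[set i | gr i == p]|)%N.
Proof.
by move=> bb exM; rewrite (dim_gens bb) dim_limg_lt_incl.
Qed.

(** * Boundary maps modulo lower grades *)

(** A column of [B] cut down to the rows of grade [p], written as a row vector so that it can serve
    as coefficients in [gens_combE]. *)
Definition local_row m m' (gr : 'I_m -> grade) (p : grade) (B : 'M['F_2]_(m, m'))
  (j : 'I_m') : 'rV['F_2]_m := \row_i (if gr i == p then B i j else 0).

Section Represented.
Variables (X : pmseq) (A : gmatrices).
Variable b : forall n (i : 'I_(gm_size A n)), X n (gm_grade i).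
Hypothesis basis_b : forall n, is_basis (@b n).
Hypothesis graded_A :
  forall n i j, gm_mx A n i j != 0 -> (gm_grade i <= gm_grade j)%O.
Hypothesis bd_b : forall n j, bd X n _ (b j) =
  \sum_i gm_mx A n i j *: pm_shift (X n) (gm_grade i) (gm_grade j) (@b n i).
Variable p : grade.

Let e n (i : 'I_(gm_size A n)) := pm_shift (X n) (gm_grade i) p (b i).
Let rad n := limg (lt_incl p (X n)).

Lemma bd_gen n (j : 'I_(gm_size A n.+1)) : (gm_grade j <= p)%O ->
  bd X n p (e j) = \sum_i gm_mx A n i j *: e i.
Proof.
move=> jp; rewrite /e pm_shift_natural bd_b linear_sum; apply: eq_bigr => i _.
rewrite linearZ /=; have [->|/graded_A ij] := eqVneq (gm_mx A n i j) 0.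
  by rewrite !scale0r.
by rewrite pm_shift_comp.
Qed.

Lemma bd_rad n x : x \in rad n.+1 -> bd X n p x \in rad n.
Proof.
by move=> /memv_imgP[y _ ->]; rewrite -lt_incl_natural memv_img ?memvf.
Qed.

(** Supplies the rank that [delta_rank] asks for. Modulo [rad n], generators of degree [n.+1]
    outside grade [p] contribute nothing to the boundaries, and a generator of grade [p] contributes
    its local row. *)
Lemma dim_rad_boundaries n :
  \dim (rad n + boundaries (at_grade X p) n)
    = (\dim (rad n)
       + \dim (\sum_(j | gm_grade j == p)
                  <[local_row (@gm_grade A n) p (gm_mx A n) j]>))%N.
Proof.
rewrite -(dim_rad_add (@basis_b n)) => [|x]; last first.
  move=> /memv_sumP[y yP ->] i /negPf ip; rewrite summxE big1 // => j jA.
  by have /vlineP[c ->] := yP j jA; rewrite !mxE ip mulr0.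
have mem_rad j : gm_grade j = p ->
    bd X n p (e j) - \sum_i local_row (@gm_grade A n) p (gm_mx A n) j 0 i *: e i
      \in rad n.
  move=> jp; rewrite bd_gen ?jp // -sumrB; apply: memv_suml => i _.
  rewrite -scalerBl mxE; case: eqVneq => [_|ip]; first by rewrite subrr scale0r mem0v.
  by rewrite rpredZ // (gen_in_rad (@b n)).
congr (\dim _); apply: subv_anti; rewrite !subv_add !addvSl /=; apply/andP; split.
  rewrite -[boundaries _ _]/(bd X n p @: fullv)%VS.
  rewrite -(rad_gens_full (@basis_b n.+1) p) limgD subv_add; apply/andP; split.
    apply: subv_trans (addvSl _ _); apply/subvP=> _ /memv_imgP[x xr ->].
    exact: bd_rad.
  rewrite limg_sum; apply/subv_sumP => j /eqP jp; rewrite limg_line -memvE.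
  rewrite -(subrK (\sum_i local_row (@gm_grade A n) p (gm_mx A n) j 0 i *: e i)
    (bd X n p _)).
  apply: memv_add; first exact: mem_rad.
  by rewrite -gens_combE memv_img // memv_sum_line ?jp.
rewrite limg_sum; apply/subv_sumP => j /eqP jp; rewrite limg_line -memvE gens_combE.
rewrite -(subKr (bd X n p (e j)) (\sum_i _)) addrC.
by apply: memv_add; rewrite ?rpredN ?mem_rad // memv_img ?memvf.
Qed.

(** The complex condition at grade [p] makes a combination of generators vanish. Terms outside grade
    [p] lie in [rad n], so [gens_indep_mod_rad] kills the coefficients in grade [p]. *)
Lemma local_mx_complex : is_complex X -> forall n i j,
  gm_grade i = p -> gm_grade j = p -> (gm_mx A n *m gm_mx A n.+1) i j = 0.
Proof.
move=> cX n i j ip jp.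
apply: (gens_indep_mod_rad (@basis_b n) (p := p)
          (a := fun i => (gm_mx A n *m gm_mx A n.+1) i j)) ip.
have: bd X n p (bd X n.+1 p (e j)) = 0 by rewrite -comp_lfunE cX zero_lfunE.
rewrite bd_gen ?jp // linear_sum /=.
under eq_bigr => k _.
  rewrite linearZ /=.
  have -> : gm_mx A n.+1 k j *: bd X n p (e k)
      = \sum_i (gm_mx A n i k * gm_mx A n.+1 k j) *: e i.
    have [->|/graded_A kj] := eqVneq (gm_mx A n.+1 k j) 0.
      by rewrite scale0r big1 // => l _; rewrite mulr0 scale0r.
    rewrite bd_gen -?jp // scaler_sumr; apply: eq_bigr => l _.
    by rewrite scalerA mulrC.
  over.
rewrite exchange_big /=.
rewrite (eq_bigr (fun l => (gm_mx A n *m gm_mx A n.+1) l j *: e l)); last first.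
  by move=> l _; rewrite -scaler_suml mxE.
rewrite (bigID (fun i => gm_grade i == p)) /= => /eqP; rewrite addr_eq0 => /eqP->.
by rewrite rpredN; apply: memv_suml => l lp; rewrite rpredZ // (gen_in_rad (@b n)).
Qed.

End Represented.

(** * Invariants of local reduction *)

Section LoopInvariants.
Variables S : Type.

Lemma while_ind_inv (step : S -> S -> Prop) (P : S -> Prop) s s' :
  (forall t t', P t -> step t t' -> P t') -> while step s s' -> P s -> P s'.
Proof. by move=> Pstep; elim=> // t t' t'' tt' _ IH /Pstep/(_ tt'). Qed.

Lemma while_stopped (step : S -> S -> Prop) s s' :
  while step s s' -> forall t, ~ step s' t.
Proof. by elim. Qed.

Lemma foreach_ord k (body : 'I_k -> S -> S -> Prop) (P : nat -> S -> Prop) s s' :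
  (forall (c : 'I_k) t t', P c t -> body c t t' -> P c.+1 t') ->
  foreach body (enum 'I_k) s s' -> P 0 s -> P k s'.
Proof.
move=> Pbody.
suff gen xs t u : map val xs = iota t (size xs) -> foreach body xs u s' ->
    P t u -> P (t + size xs)%N s'.
  by have := gen (enum 'I_k) 0%N s; rewrite val_enum_ord size_enum_ord; apply.
elim: xs t u => [|c xs IH] t u /=; first by rewrite addn0 => _ ->.
move=> [ct xsE] [s1 bs1 fs1] Pts; rewrite addnS -addSn.
by apply: IH fs1 _ => //; rewrite -ct; apply: Pbody bs1; rewrite ct.
Qed.

Lemma foreach_rev_iota N (body : nat -> S -> S -> Prop) (P : nat -> S -> Prop) s s' :
  (forall n t t', (n < N)%N -> P n.+1 t -> body n t t' -> P n t') ->
  foreach body (rev (iota 0 N)) s s' -> P N s -> P 0 s'.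
Proof.
elim: N s => [|N IH] s Pbody; first by move=> /= ->.
rewrite -[in iota _ _]addn1 iotaD rev_cat add0n /= => -[s1 bs fs] PN.
apply: IH fs _ => [n t t' nN|]; first by apply: Pbody; apply: ltnW.
exact: Pbody bs.
Qed.

End LoopInvariants.

Section MatrixInvariants.
Variables (m : nat -> nat) (gr : forall n, 'I_(m n) -> grade).

Lemma set_mx_in (D : matrices m) n B : set_mx D B n = B.
Proof. exact: dfwith_in. Qed.

Lemma set_mx_out (D : matrices m) n (B : 'M_(m n, m n.+1)) k :
  n != k -> set_mx D B k = D k.
Proof. by move=> nk; apply: dfwith_out. Qed.

(** Generators paired with their degree, so that those of different degrees can be tested for
    equality. *)
Let gen k (i : 'I_(m k)) := Tagged (fun k => 'I_(m k)) i.

Lemma set_labelE (L : labelling m) n (i : 'I_(m n)) l k (j : 'I_(m k)) :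
  set_label L i l j = if gen j == gen i then Some l else L k j.
Proof.
rewrite /set_label; have [nk|nk] := eqVneq n k.
  by case: k / nk j => j; rewrite dfwith_in eq_Tagged.
rewrite dfwith_out //; case: eqP => // /(congr1 tag) /= kn.
by rewrite kn eqxx in nk.
Qed.

Definition graded_mx n (B : 'M['F_2]_(m n, m n.+1)) : Prop :=
  forall i j, B i j != 0 -> (gr i <= gr j)%O.

(** The form of a product of additions of an earlier column to a later one of the same grade. *)
Definition graded_unitri k (U : 'M['F_2]_(m k)) : Prop :=
  [/\ forall j, U j j = 1, forall i j, U i j != 0 -> (i <= j)%N
    & forall i j, U i j != 0 -> gr i = gr j].

(** The factor stands beside the reduced matrix, so that the original columns expand directly in the
    reduced ones. *)
Definition reduced_from n (D0 D : 'M['F_2]_(m n, m n.+1)) : Prop :=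
  exists2 U, graded_unitri U & D0 = D *m U.

Lemma reduced_from_refl n (D : 'M_(m n, m n.+1)) : reduced_from D D.
Proof.
exists 1%:M; last by rewrite mulmx1.
by split=> [j|i j|i j]; rewrite mxE ?eqxx //; have [->|] := eqVneq i j; rewrite ?eqxx.
Qed.

(* Over F_2 the elementary column operation is its own inverse. *)
Lemma reduced_from_add n (D0 D D' : 'M_(m n, m n.+1)) (c c' : 'I_(m n.+1)) :
  (c' < c)%N -> gr c' = gr c ->
  D' = \matrix_(i, j) (if j == c then D i c + D i c' else D i j) ->
  reduced_from D0 D -> reduced_from D0 D'.
Proof.
move=> lt_c gr_c D'E [U [U1 Ule Ugr] D0E].
(* Adding column [c'] to column [c] of [D] is compensated by adding row [c] to row [c'] of [U]. *)
exists (\matrix_(i, j) if i == c' then U c' j + U c j else U i j).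
  split=> [j|i j|i j]; rewrite mxE.
  - have [->|//] := eqVneq j c'; rewrite U1.
    by case: (eqVneq (U c c') 0) => [->|/Ule]; rewrite ?addr0 // leqNgt lt_c.
  - have [->|_] := eqVneq i c'; last exact: Ule.
    case: (eqVneq (U c j) 0) => [->|/Ule cj _]; first by rewrite addr0; apply: Ule.
    exact: ltnW (leq_trans lt_c cj).
  - have [->|_] := eqVneq i c'; last exact: Ugr.
    case: (eqVneq (U c j) 0) => [->|/Ugr cj _]; first by rewrite addr0; apply: Ugr.
    by rewrite gr_c.
have cc' : c' != c by rewrite neq_ltn lt_c.
rewrite {}D0E {}D'E; apply/matrixP=> i j; rewrite !mxE.
have delta a (f : 'I_(m n.+1) -> 'F_2) : \sum_k (if k == a then f k else 0) = f a.
  by rewrite -big_mkcond big_pred1_eq.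
have two (x : 'F_2) : x + x = 0 by rewrite -mulr2n -mulr_natl pchar_Zp ?mul0r.
pose f k := (if k == c then D i c' * U k j else 0)
  + (if k == c' then D i k * U c j else 0).
rewrite [RHS](eq_bigr (fun k => D i k * U k j + f k)) => [|k _]; last first.
  rewrite !mxE /f; have [->|_] := eqVneq k c.
    by rewrite eq_sym (negPf cc') addr0 mulrDl.
  by have [->|_] := eqVneq k c'; rewrite ?addr0 // add0r mulrDr.
by rewrite !big_split /= !delta two addr0.
Qed.

End MatrixInvariants.

(** * Labels and local pivots during Phase I *)

Section Phase1.
Variables (m : nat -> nat) (gr : forall n, 'I_(m n) -> grade).
Variable D0 : matrices m.

Let gen k (i : 'I_(m k)) := Tagged (fun k => 'I_(m k)) i.
Let lpiv (D : matrices m) n (r : 'I_(m n)) c := is_local_pivot gr D r c.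

(* [mi_complex] is restricted to equal grades because there it follows from
   [d o d = 0] by independence modulo lower grades alone. *)
Record matrix_inv (D : matrices m) : Prop := MatrixInv {
  mi_reduced : forall n, reduced_from gr (D0 n) (D n);
  mi_graded : forall n, graded_mx gr (D n);
  mi_complex : forall n i j, gr i = gr j -> (D0 n *m D n.+1) i j = 0
}.

Lemma add_column_in (D : matrices m) n (c c' : 'I_(m n.+1)) :
  add_column D c c' n = \matrix_(i, j) if j == c then D n i c + D n i c' else D n i j.
Proof. exact: set_mx_in. Qed.

(** The left factor in [mi_complex] is the fixed [D0], so this condition is linear in the changed
    column. *)
Lemma matrix_inv_add (D : matrices m) n (c c' : 'I_(m n.+1)) :
  (c' < c)%N -> gr c' = gr c -> matrix_inv D -> matrix_inv (add_column D c c').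
Proof.
move=> lt_c gr_c [red grd cpx]; split=> k.
- have [<-|nk] := eqVneq n k; last by rewrite /add_column set_mx_out.
  exact: reduced_from_add lt_c gr_c (add_column_in D c c') (red n).
- have [<-|nk] := eqVneq n k; last by rewrite /add_column set_mx_out.
  move=> i j; rewrite add_column_in mxE; have [->|_] := eqVneq j c; last exact: grd.
  have [->|/grd//] := eqVneq (D n i c) 0; rewrite add0r => /grd.
  by rewrite gr_c.
have [nk|nk] := eqVneq n k.+1; last first.
  by move=> i j; rewrite /add_column set_mx_out //; apply: cpx.
subst n; move=> i j ij; rewrite add_column_in; have [jc|jc] := eqVneq j c.
  transitivity ((D0 k *m D k.+1) i c + (D0 k *m D k.+1) i c').
    by rewrite !mxE -big_split; apply: eq_bigr => l _; rewrite mxE jc eqxx mulrDr.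
  by rewrite !cpx ?addr0 // ?gr_c -jc.
rewrite -(cpx k i j ij) !mxE; apply: eq_bigr => l _.
by rewrite mxE (negPf jc).
Qed.

Lemma lpiv_add (D : matrices m) n (c c' : 'I_(m n.+1)) k r (c1 : 'I_(m k.+1)) :
  gen c1 != gen c -> lpiv (add_column D c c') r c1 = lpiv D r c1.
Proof.
have [nk|nk] := eqVneq n k; last first.
  by rewrite /lpiv /is_local_pivot /is_pivot /add_column set_mx_out.
subst n; rewrite /gen eq_Tagged /= => /negPf c1c.
rewrite /lpiv /is_local_pivot /is_pivot add_column_in mxE c1c.
by do 2![congr (_ && _)]; apply: eq_forallb => i; rewrite mxE c1c.
Qed.

Lemma reduce_while n (c : 'I_(m n.+1)) (D D' : matrices m) :
  while (reduce_step gr c) D D' -> matrix_inv D ->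
  matrix_inv D' /\
  forall k r (c1 : 'I_(m k.+1)), gen c1 != gen c -> lpiv D' r c1 = lpiv D r c1.
Proof.
move=> wDD' inv.
pose P t := matrix_inv t /\
  forall k r (c1 : 'I_(m k.+1)), gen c1 != gen c -> lpiv t r c1 = lpiv D r c1.
apply: (while_ind_inv (P := P) _ wDD'); last by [].
move=> t t' [inv_t same] [r [c' [/andP[_ /eqP rc] lt_c /andP[_ /eqP rc'] ->]]].
split; first by apply: matrix_inv_add; rewrite // -rc'.
by move=> k r1 c1 c1c; rewrite lpiv_add // same.
Qed.

(** Generators that are not [done] may already be local positive, because Phase I labels pivots in a
    degree before it reaches the columns of that degree. [li_inj] prevents two negative columns from
    sharing a local pivot. *)
Record label_inv (done : forall k, 'I_(m k) -> bool) (D : matrices m)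
    (L : labelling m) : Prop := LabelInv {
  li_done : forall k i, @done k i -> L k i <> None;
  li_todo : forall k i, ~~ @done k i -> L k i = None \/ L k i = Some LocalPositive;
  li_negative : forall k c, L k.+1 c = Some LocalNegative ->
    exists2 r, lpiv D r c & L k r = Some LocalPositive;
  li_global : forall k c, L k.+1 c = Some Global -> forall r, ~~ lpiv D r c;
  li_positive : forall k r, L k r = Some LocalPositive ->
    exists2 c, L k.+1 c = Some LocalNegative & lpiv D r c;
  li_inj : forall k c c' r, L k.+1 c = Some LocalNegative ->
    L k.+1 c' = Some LocalNegative -> lpiv D r c -> lpiv D r c' -> c = c'
}.


(* Phase I has finished the matrices of index greater than [n] and the first [t]
   columns of the matrix of index [n]. *)
Definition done_upto n t k (i : 'I_(m k)) : bool :=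
  (n.+1 < k)%N || (k == n.+1) && (i < t)%N.

Definition state_inv (done : forall k, 'I_(m k) -> bool) (s : state m) : Prop :=
  matrix_inv (st_mx s) /\ label_inv done (st_mx s) (st_label s).

Lemma done_uptoS n (c : 'I_(m n.+1)) k (j : 'I_(m k)) :
  done_upto n c.+1 j = (gen j == gen c) || done_upto n c j.
Proof.
rewrite /done_upto; have [kn|kn] := eqVneq k n.+1; last first.
  rewrite !orbF; case: eqP => // /(congr1 tag) /= /eqP.
  by rewrite (negPf kn).
by subst k; rewrite /gen eq_Tagged ltnn ltnS leq_eqVlt.
Qed.

(** The delicate case is a new negative column: termination of the loop keeps the local pivots of
    negative columns distinct, and its pivot [r], being in a degree not yet processed, carries no
    conflicting label. *)
Lemma process_column_inv n (c : 'I_(m n.+1)) s s' :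
  state_inv (done_upto n c) s -> process_column gr c s s' ->
  state_inv (done_upto n c.+1) s'.
Proof.
case: s => D L [/= Minv [done todo neg glob pos inj]]; rewrite /process_column /=.
case Lc: (L n.+1 c) => [l|].
  move=> ->; split=> //=; split=> // k i; rewrite done_uptoS.
    case/orP=> [|/done//]; have [kn|kn] := eqVneq k n.+1; last first.
      by move=> /eqP/(congr1 tag)/= /eqP; rewrite (negPf kn).
    by subst k; rewrite /gen eq_Tagged /= => /eqP->; rewrite Lc.
  by rewrite negb_or => /andP[_]; apply: todo.
move=> [D' wDD' Ds']; have stop := while_stopped wDD'.
have [Minv' same] := reduce_while wDD' Minv.
have Lgen k (j : 'I_(m k)) : L k j <> None -> (gen j == gen c) = false.
  move=> Lj; apply/negP => /eqP jc; apply: Lj.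
  by rewrite -[L k j]/((fun u => L (tag u) (tagged u)) (gen j)) jc.
have genP k (c1 : 'I_(m k.+1)) (P : forall k, 'I_(m k.+1) -> Prop) :
    gen c1 == gen c -> P n c -> P k c1.
  move=> c1c; have /eqP/(congr1 tag)/= [kn] := c1c; subst k.
  by move: c1c; rewrite /gen eq_Tagged /= => /eqP->.
case: Ds' => [[r rc ->]|[nopiv ->]]; split=> //=; last first.
  set L' := set_label L c Global.
  have L'E k (j : 'I_(m k)) : L' k j = if gen j == gen c then Some Global else L k j.
    exact: set_labelE.
  split=> k.
  - by move=> i; rewrite done_uptoS L'E; case: ifP => //= _; apply: done.
  - by move=> i; rewrite done_uptoS L'E negb_or => /andP[/negPf-> /todo].
  - move=> c1; rewrite L'E; case: ifP => // c1c /neg[r rc1 Lr].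
    by exists r; rewrite ?same ?c1c // L'E Lgen ?Lr.
  - move=> c1; rewrite L'E; case: ifP => [c1c _|c1c /glob piv r]; last first.
      by rewrite same ?c1c.
    exact: (genP k c1 (fun k c1 => forall r, ~~ lpiv D' r c1)) c1c nopiv.
  - move=> r; rewrite L'E; case: ifP => // _ /pos[c1 Lc1 rc1]; exists c1.
      by rewrite L'E Lgen ?Lc1.
    by rewrite same ?Lgen ?Lc1.
  move=> c1 c2 r; rewrite !L'E; case: ifP => // n1; case: ifP => // n2 L1 L2.
  by rewrite !same ?n1 ?n2 //; apply: inj.
set L' := set_label _ r LocalPositive.
have L'E k (j : 'I_(m k)) : L' k j = if gen j == gen r then Some LocalPositive
    else if gen j == gen c then Some LocalNegative else L k j.
  by rewrite /L' !set_labelE.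
have rc_neq : (gen c == gen r) = false.
  by apply/negP => /eqP/(congr1 tag)/= /eqP; rewrite eqn_leq ltnn.
have Lr : L n r = None \/ L n r = Some LocalPositive.
  by apply: todo; rewrite /done_upto ltnNge leqnSn ltn_eqF.
have Lgenr k (j : 'I_(m k)) :
    L k j <> None -> L k j <> Some LocalPositive -> (gen j == gen r) = false.
  move=> Lj Lj'; apply/negP => /eqP jr.
  by case: Lr; rewrite -[L n r]/((fun u => L (tag u) (tagged u)) (gen r)) -jr.
(* A negative column [c2] is already done, hence precedes [c]; a shared local pivot would permit a
   further step of the finished loop. *)
have new_piv (c2 : 'I_(m n.+1)) r1 :
    L n.+1 c2 = Some LocalNegative -> lpiv D' r1 c -> lpiv D' r1 c2 -> False.
  move=> L2 r1c r1c2; apply: (stop (add_column D' c c2)); exists r1, c2; split=> //.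
  have : done_upto n c c2 by apply/negPn/negP => /todo[]; rewrite L2.
  by rewrite /done_upto ltnn eqxx.
split=> k.
- by move=> i; rewrite done_uptoS L'E; do 2!case: ifP => //= _; apply: done.
- move=> i; rewrite done_uptoS L'E negb_or => /andP[/negPf-> /todo].
  by case: ifP => //; right.
- move=> c1; rewrite L'E; case: ifP => // c1r; case: ifP => // [c1c _|c1c].
    apply: (genP k c1 (fun k c1 => exists2 r0, lpiv D' r0 c1 & L' k r0 = _)) c1c _.
    by exists r; rewrite // L'E eqxx.
  move=> /neg[r1 r1c1 Lr1]; exists r1; first by rewrite same ?c1c.
  by rewrite L'E; case: ifP => // _; rewrite Lgen ?Lr1.
- move=> c1; rewrite L'E; case: ifP => // c1r; case: ifP => // c1c /glob piv r1.
  by rewrite same ?c1c.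
- move=> r1; rewrite L'E; case: ifP => [r1r _|_].
    have /eqP/(congr1 tag)/= kn := r1r; subst k.
    move: r1r; rewrite /gen eq_Tagged /= => /eqP->; exists c => //.
    by rewrite L'E rc_neq eqxx.
  case: ifP => // _ /pos[c1 Lc1 r1c1]; exists c1; first by rewrite L'E Lgenr ?Lgen ?Lc1.
  by rewrite same ?Lgen ?Lc1.
move=> c1 c2 r1; rewrite !L'E; case: ifP => // _; case: ifP => // n1.
  move=> _; case: ifP => // _; case: ifP => // n2 => [_ _ _|].
    have /eqP/(congr1 tag)/= [kn] := n1; subst k.
    by move: n1 n2; rewrite /gen !eq_Tagged /= => /eqP-> /eqP->.
  have /eqP/(congr1 tag)/= [kn] := n1; subst k.
  move: n1; rewrite /gen eq_Tagged /= => /eqP-> L2 r1c r1c2.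
  by case: (new_piv _ _ L2 r1c r1c2).
move=> L1; case: ifP => // _; case: ifP => // n2 => [_|L2].
  have /eqP/(congr1 tag)/= [kn] := n2; subst k.
  move: n2; rewrite /gen eq_Tagged /= => /eqP-> r1c1 r1c.
  by case: (new_piv _ _ L1 r1c r1c1).
by rewrite !same ?n1 ?n2 //; apply: inj.
Qed.

Lemma matrix_inv_init : (forall n, graded_mx gr (D0 n)) ->
  (forall n i j, gr i = gr j -> (D0 n *m D0 n.+1) i j = 0) -> matrix_inv D0.
Proof. by move=> grd cpx; split=> // n; apply: reduced_from_refl. Qed.

(** The loop ends with all positive degrees done. The generators of degree 0 are then unlabeled or
    local positive, so [label_degree0] completes the labelling without creating a negative one. *)
Lemma phase1_inv N s :
  (forall n, (N < n)%N -> m n = 0) -> matrix_inv D0 ->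
  phase1 gr N (State D0 (fun _ _ => None)) s ->
  [/\ matrix_inv (st_mx s), label_inv (fun _ _ => true) (st_mx s) (st_label s)
    & forall i : 'I_(m 0), st_label s i <> Some LocalNegative].
Proof.
move=> m0 Minv [s1 loop ->].
pose J n := state_inv (fun k (_ : 'I_(m k)) => n < k)%N.
have ext (d d' : forall k, 'I_(m k) -> bool) t :
    (forall k i, d k i = d' k i) -> state_inv d t -> state_inv d' t.
  move=> dd' [Mt [done todo neg glob pos inj]]; split=> //; split=> //.
    by move=> k i; rewrite -dd'; apply: done.
  by move=> k i; rewrite -dd'; apply: todo.
have JN : J N (State D0 (fun _ _ => None)).
  split=> //=; split=> //= [k i Nk|k i _]; last by left.
  by have := ltn_ord i; rewrite {2}m0.
have [] : J 0%N s1.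
  apply: (foreach_rev_iota _ loop JN) => n t t' _ Jt loop_n.
  (* Having done all [m n.+1] columns amounts to having done every degree above [n]. *)
  apply: (ext (@done_upto n (m n.+1))) => [k i|].
    rewrite /done_upto [RHS]leq_eqVlt orbC eq_sym; case: eqP => //= kn.
    by subst k; rewrite ltn_ord.
  apply: (foreach_ord (P := fun j => state_inv (@done_upto n j)) _ loop_n).
    by move=> c u u'; apply: process_column_inv.
  by apply: ext Jt => k i; rewrite /done_upto andbF orbF.
move=> Ms1 [done todo neg glob pos inj]; rewrite /label_degree0 /=.
set L' := dfwith _ _.
have L'S k : L' k.+1 = @st_label _ s1 k.+1 by rewrite /L' dfwith_out.
have L'0 (i : 'I_(m 0)) : L' 0%N i =
    if st_label s1 i is Some l then Some l else Some Global.
  by rewrite /L' dfwith_in.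
split=> // [|i]; last first.
  by rewrite L'0; have [//||] := todo 0%N i => ->.
split=> //.
- case=> [i _|k i _]; first by rewrite L'0; case: (st_label s1 i).
  by rewrite L'S; apply: done.
- move=> k c; rewrite L'S => /neg[r rc Lr]; exists r => //.
  by case: k c r rc Lr => [|k] c r rc Lr; rewrite ?L'S ?L'0 Lr.
- by move=> k c; rewrite L'S; apply: glob.
- case=> [|k] r.
    rewrite L'0 => L0; have [|c Lc rc] := pos 0%N r; last by exists c; rewrite ?L'S.
    by move: L0; case: (st_label s1 r).
  by rewrite L'S => /pos[c Lc rc]; exists c; rewrite ?L'S.
by move=> k c c' r; rewrite !L'S; apply: inj.
Qed.

End Phase1.

(** * Ranks and labels *)

Definition is_negative (l : option label) : bool :=
  if l is Some LocalNegative then true else false.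

Definition is_positive (l : option label) : bool :=
  if l is Some LocalPositive then true else false.

Section Counting.
Variables (m : nat -> nat) (gr : forall n, 'I_(m n) -> grade).
Variables (D0 D : matrices m) (L : labelling m).
Hypothesis Minv : matrix_inv gr D0 D.
Hypothesis Linv : label_inv gr (fun _ _ => true) D L.
Hypothesis gr_order : forall n (i j : 'I_(m n)), (gr i < gr j)%O -> (i < j)%N.
Variable p : grade.

Definition negatives n := [set c : 'I_(m n) | is_negative (L c) && (gr c == p)].
Definition positives n := [set c : 'I_(m n) | is_positive (L c) && (gr c == p)].
Definition globals n := [set c : 'I_(m n) | is_global (L c) && (gr c == p)].

Lemma negativeE n (c : 'I_(m n)) : is_negative (L c) -> L c = Some LocalNegative.
Proof. by case: (L c) => [[]|]. Qed.

Lemma positiveE n (c : 'I_(m n)) : is_positive (L c) -> L c = Some LocalPositive.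
Proof. by case: (L c) => [[]|]. Qed.

Lemma local_pivot_uniq n (r r' : 'I_(m n)) c :
  is_local_pivot gr D r c -> is_local_pivot gr D r' c -> r = r'.
Proof.
move=> /andP[/andP[r0 /forallP rmax] _] /andP[/andP[r0' /forallP rmax'] _].
apply/val_inj/anti_leq; rewrite (implyP (rmax _)) //.
by rewrite (implyP (rmax' _)).
Qed.

(** Double counting of incidences between local pivots and negative columns: each positive row and
    each negative column occurs exactly once. *)
Lemma card_positives n : #|positives n| = #|negatives n.+1|.
Proof.
rewrite -!sum1_card.
pose f (r : 'I_(m n)) (c : 'I_(m n.+1)) : nat := is_local_pivot gr D r c.
transitivity (\sum_(r in positives n) \sum_(c in negatives n.+1) f r c)%N.
  apply: eq_bigr => r; rewrite inE => /andP[/positiveE Lr /eqP rp].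
  have [c Lc rc] := li_positive Linv Lr.
  have cN : c \in negatives n.+1.
    by rewrite inE Lc -(eqP (proj2 (andP rc))) rp /=.
  rewrite (bigD1 c) //= /f rc big1 // => c' /andP[]; rewrite inE.
  move=> /andP[/negativeE Lc' _] cc'; apply/eqP; rewrite eqb0; apply: contra cc'.
  by move=> rc'; apply/eqP; apply: (li_inj Linv) rc' rc.
rewrite exchange_big /=; apply: eq_bigr => c; rewrite inE => /andP[/negativeE Lc cp].
have [r rc Lr] := li_negative Linv Lc.
have rP : r \in positives n by rewrite inE Lr (eqP (proj2 (andP rc))).
rewrite (bigD1 r) //= /f rc big1 // => r' /andP[_ rr'].
by apply/eqP; rewrite eqb0; apply: contra rr' => r'c;
  apply/eqP/(local_pivot_uniq r'c rc).
Qed.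

Lemma card_gens n :
  #|[set i : 'I_(m n) | gr i == p]|
    = (#|globals n| + #|negatives n| + #|positives n|)%N.
Proof.
rewrite -!sum1dep_card big_mkcond [X in (X + _ + _)%N]big_mkcond.
rewrite [X in (_ + X + _)%N]big_mkcond [X in (_ + _ + X)%N]big_mkcond.
rewrite -!big_split /=; apply: eq_bigr => i _.
have := @li_done _ _ _ _ _ Linv n i erefl.
by case: (gr i == p); rewrite ?andbT ?andbF //; case: (L i) => [[]|].
Qed.

(** Suppose a global column had a nonzero entry in grade [p], and let [r] be its last nonzero row.
    Gradedness bounds the grade of [r] by [p], and a smaller grade would place [r] before that entry
    by [gr_order]. So [r] would be a local pivot. *)
Lemma local_row_global n (c : 'I_(m n.+1)) : L c = Some Global -> gr c = p ->
  local_row (@gr n) p (D n) c = 0.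
Proof.
move=> Lc cp; apply/rowP=> i; rewrite !mxE; case: eqP => // ip.
apply/eqP/negPn/negP => Dic.
pose r := [arg max_(j > i | D n j c != 0) (j : nat)].
have [Drc rmax] : D n r c != 0 /\ forall j, D n j c != 0 -> (j <= r)%N.
  by rewrite /r; case: arg_maxnP.
have /negP := li_global Linv Lc r; apply; apply/andP; split.
  by rewrite /is_pivot Drc; apply/forallP => j; apply/implyP/rmax.
have := mi_graded Minv Drc; rewrite le_eqVlt => /orP[//|].
rewrite cp -ip => /gr_order; rewrite ltnNge rmax //.
Qed.

Lemma initial_graded n : graded_mx gr (D0 n).
Proof.
move=> i k; have [U [_ _ Ugr] ->] := mi_reduced Minv n; rewrite mxE => sum0.
have [l] : exists l, D n i l * U l k != 0.
  apply/existsP; apply: contraNT sum0; rewrite negb_exists => /forallP D0U.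
  by rewrite big1 // => l _; apply/eqP; rewrite -[_ == _]negbK.
by rewrite mulf_eq0 negb_or => /andP[/(mi_graded Minv) il /Ugr <-].
Qed.

(* A local positive generator is the pivot of a column [v] of the next matrix,
   on which [D0 n] vanishes in grade [p]; this expresses its column through
   columns of smaller index. *)
Lemma local_row_positive n (c : 'I_(m n.+1)) : L c = Some LocalPositive -> gr c = p ->
  exists a : 'I_(m n.+1) -> 'F_2,
    local_row (@gr n) p (D n) c
      = \sum_(k : 'I_(m n.+1) | (k < c)%N && (gr k == p))
          a k *: local_row (@gr n) p (D n) k.
Proof.
move=> Lc cp.
have [c2 Lc2 /andP[/andP[vc /forallP vmax] /eqP c2p]] := li_positive Linv Lc.
have [U [U1 Ule Ugr] D0E] := mi_reduced Minv n.
(* By [D0E], these are the coefficients, on the columns of [D n], of the combination of columns of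
   [D0 n] given by the grade-[p] part of column [c2]. *)
pose w := U *m (\col_k (if gr k == p then D n.+1 k c2 else 0)).
have w_gr k : w k 0 != 0 -> gr k = p.
  apply: contraNeq => kp; rewrite mxE big1 // => l _; rewrite mxE.
  have [lp|] := eqVneq (gr l) p; last by rewrite mulr0.
  have [->|/Ugr kl] := eqVneq (U k l) 0; first by rewrite mul0r.
  by rewrite kl lp eqxx in kp.
have w_le k : w k 0 != 0 -> (k <= c)%N.
  rewrite leqNgt; apply: contra => ck; rewrite mxE big1 // => l _; rewrite mxE.
  have [->|/Ule kl] := eqVneq (U k l) 0; first by rewrite mul0r.
  have [lp|] := eqVneq (gr l) p; last by rewrite mulr0.
  have [->|/(implyP (vmax l)) lc] := eqVneq (D n.+1 l c2) 0; first by rewrite mulr0.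
  by have := leq_ltn_trans (leq_trans kl lc) ck; rewrite ltnn.
have wc : w c 0 != 0.
  rewrite mxE (bigD1 c) //= big1 => [|l lc]; rewrite mxE.
    by rewrite U1 mul1r addr0 cp eqxx.
  have [->|/Ule cl] := eqVneq (U c l) 0; first by rewrite mul0r.
  have [lp|] := eqVneq (gr l) p; last by rewrite mulr0.
  have [->|/(implyP (vmax l)) cl'] := eqVneq (D n.+1 l c2) 0; first by rewrite mulr0.
  by case/eqP: lc; apply/val_inj/anti_leq; rewrite cl cl'.
have Dw i : gr i = p -> \sum_k D n i k * w k 0 = 0.
  move=> ip; transitivity ((D0 n *m D n.+1) i c2).
    transitivity ((D n *m w) i 0); first by rewrite mxE.
    rewrite /w mulmxA -D0E !mxE; apply: eq_bigr => k _; rewrite mxE.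
    (* Outside grade [p] the product is zero: two nonzero factors would squeeze [gr k] between
       [gr i] and [gr c2], both equal to [p]. *)
    have [//|kp] := eqVneq (gr k) p; rewrite mulr0.
    have [->|/(mi_graded Minv) kc] := eqVneq (D n.+1 k c2) 0; first by rewrite mulr0.
    have [->|/initial_graded ik] := eqVneq (D0 n i k) 0; first by rewrite mul0r.
    by case/eqP: kp; apply: le_anti; rewrite -{1}cp c2p kc -ip ik.
  by apply: (mi_complex Minv); rewrite ip -c2p.
clearbody w; exists (fun k => - (w k 0 / w c 0)).
apply: (scalerI wc); rewrite scaler_sumr; apply/rowP=> i.
rewrite summxE !mxE; have [ip|ip] := eqVneq (gr i) p; last first.
  by rewrite mulr0 big1 // => k _; rewrite !mxE (negPf ip) !mulr0.
have := Dw i ip; rewrite (bigD1 c) //= => /eqP.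
rewrite addr_eq0 [w c 0 * _]mulrC => /eqP->.
rewrite (bigID (fun k : 'I__ => (k < c)%N && (gr k == p))) /= [X in _ + X]big1.
  rewrite addr0 -sumrN; apply: eq_big => [k|k _].
    by case: eqP => // ->; rewrite ltnn.
  by rewrite !mxE ip eqxx mulrA mulrN mulrCA divff // mulr1 mulrC mulNr.
move=> k /andP[kc kcp]; have [->|wk] := eqVneq (w k 0) 0; first by rewrite mulr0.
by move: kcp; rewrite (w_gr k wk) eqxx andbT ltn_neqAle kc w_le.
Qed.

(** Both sides are the span of all local rows of [D n] in grade [p]: the left one because [U] is
    unitriangular within a grade, the right one because global rows vanish and positive ones reduce
    to columns of smaller index. *)
Lemma sum_local_rows n :
  (\sum_(j | gr j == p) <[local_row (@gr n) p (D0 n) j]>)%VS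
    = (\sum_(c in negatives n.+1) <[local_row (@gr n) p (D n) c]>)%VS.
Proof.
have [U [U1 Ule Ugr] D0E] := mi_reduced Minv n.
have rowE j : gr j = p -> local_row (@gr n) p (D0 n) j
    = local_row (@gr n) p (D n) j
      + \sum_(k : 'I_(m n.+1) | (k < j)%N && (gr k == p))
          U k j *: local_row (@gr n) p (D n) k.
  move=> jp; apply/rowP=> i; rewrite !mxE summxE; have [ip|ip] := eqVneq (gr i) p.
    rewrite D0E mxE (bigD1 j) //= U1 mulr1; congr (_ + _).
    rewrite (bigID (fun k : 'I__ => (k < j)%N && (gr k == p))) /= [X in _ + X]big1.
      rewrite addr0; apply: eq_big => [k|k _].
        by case: eqP => // ->; rewrite ltnn.
      by rewrite !mxE ip eqxx mulrC.
    move=> k /andP[kj kjp]; have [->|Ukj] := eqVneq (U k j) 0; first by rewrite mulr0.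
    by move: kjp; rewrite (Ugr _ _ Ukj) jp eqxx andbT ltn_neqAle kj Ule.
  by rewrite add0r big1 // => k _; rewrite !mxE (negPf ip) mulr0.
set TN := (RHS).
have inTN j : gr j = p -> local_row (@gr n) p (D n) j \in TN.
  have [k] := ubnP (j : nat); elim: k j => // k IH j jk jp.
  have := @li_done _ _ _ _ _ Linv n.+1 j erefl.
  case Lj: (L j) => [[]|] // _.
  - by rewrite local_row_global ?mem0v.
  - by rewrite /TN (memv_sum_line (local_row (@gr n) p (D n))) // inE Lj jp eqxx.
  have [a ->] := local_row_positive Lj jp.
  apply: memv_suml => l /andP[lj /eqP lp]; apply/rpredZ/IH => //.
  exact: leq_trans lj jk.
apply: subv_anti; apply/andP; split.
  apply/subv_sumP => j /eqP jp; rewrite -memvE rowE // rpredD ?inTN //.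
  by apply: memv_suml => k /andP[_ /eqP kp]; rewrite rpredZ ?inTN.
apply/subv_sumP => j; rewrite inE -memvE => /andP[_ /eqP].
(* Back substitution in [rowE], by strong induction on the index. *)
have [k] := ubnP (j : nat); elim: k j => // k IH j jk jp.
rewrite -[local_row _ _ (D n) j](addrK
  (\sum_(k : 'I_(m n.+1) | (k < j)%N && (gr k == p))
          U k j *: local_row (@gr n) p (D n) k)).
rewrite -rowE // rpredB ?(memv_sum_line (local_row (@gr n) p (D0 n))) ?jp //.
apply: memv_suml => l /andP[lj /eqP lp]; apply/rpredZ/IH => //.
exact: leq_trans lj jk.
Qed.

(** Negative columns have distinct pivots. In a vanishing combination, the column with the largest
    pivot among those with nonzero coefficient is the only one of them with a nonzero entry in that
    row, a contradiction. *)
Lemma dim_local_rows n :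
  \dim (\sum_(j | gr j == p) <[local_row (@gr n) p (D0 n) j]>) = #|negatives n.+1|.
Proof.
rewrite sum_local_rows; apply: dim_sumv_lines => a sum0 i iN.
apply/eqP/negPn/negP => ai.
(* On a zero column, which has no pivot, the maximum is [0]. *)
pose piv (c : 'I_(m n.+1)) := (\max_(i < m n | D n i c != 0%R) i)%N.
have pivE r c : is_pivot D r c -> piv c = r.
  move=> /andP[rc /forallP rmax]; apply/anti_leq; rewrite leq_bigmax_cond // andbT.
  by apply/bigmax_leqP => j; apply/implyP/rmax.
have [c /andP[cN ac] cmax] : exists2 c, (c \in negatives n.+1) && (a c != 0)
    & forall c', (c' \in negatives n.+1) && (a c' != 0) -> (piv c' <= piv c)%N.
  pose Q c := (c \in negatives n.+1) && (a c != 0).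
  have Qi : Q i by rewrite /Q iN.
  by exists [arg max_(c > i | Q c) piv c]; case: arg_maxnP.
move: (cN); rewrite inE => /andP[/negativeE Lc /eqP cp].
have [r rc _] := li_negative Linv Lc.
have [rcp /eqP rp] := andP rc; have [Drc _] := andP rcp.
have := congr1 (fun v : 'rV_(m n) => v 0 r) sum0.
rewrite summxE (bigD1 c) //= big1 => [|c' /andP[c'N c'c]].
  rewrite !mxE rp cp eqxx addr0 => /eqP; rewrite mulf_eq0 (negPf ac).
  by rewrite (negPf Drc).
rewrite !mxE rp cp eqxx; have [->|ac'] := eqVneq (a c') 0; first by rewrite mul0r.
have [->|Drc'] := eqVneq (D n r c') 0; first by rewrite mulr0.
move: (c'N); rewrite inE => /andP[/negativeE Lc' _].
have [r' rc' _] := li_negative Linv Lc'.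
have [rcp' _] := andP rc'; have [_ /forallP rmax'] := andP rcp'.
have r_le : (r <= r')%N by apply: (implyP (rmax' r)).
have r'_le : (r' <= r)%N.
  by rewrite -(pivE _ _ rcp) -(pivE _ _ rcp') cmax // c'N.
have rr' : r = r' by apply/val_inj/anti_leq; rewrite r_le.
case/eqP: c'c; apply: (li_inj Linv Lc' Lc) rc' _.
by rewrite -rr'.
Qed.

(** The ranks of the two adjacent local matrices count the negatives and the positives of degree
    [n]; in degree 0 there is no lower matrix and, by hypothesis, no negative. *)
Lemma card_globals n : (forall i : 'I_(m 0), L i <> Some LocalNegative) ->
  (#|globals n| + (if n is n'.+1 then
     \dim (\sum_(j | gr j == p) <[local_row (@gr n') p (D0 n') j]>) else 0)
   + \dim (\sum_(j | gr j == p) <[local_row (@gr n) p (D0 n) j]>)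
   = #|[set i : 'I_(m n) | gr i == p]|)%N.
Proof.
move=> L0; rewrite card_gens dim_local_rows card_positives; case: n => [|n].
  congr (_ + _ + _)%N; apply/esym/eqP; rewrite cards_eq0 -subset0.
  by apply/subsetP => i; rewrite inE => /andP[/negativeE/L0].
by rewrite dim_local_rows.
Qed.

End Counting.

(** * Generators of the output and the conclusion *)

Lemma card_phase3 (m : nat -> nat) (gr : forall n, 'I_(m n) -> grade)
    (L : labelling m) (D : matrices m) n p :
  #|[set i : 'I_(gm_size (phase3 gr L D) n) | gm_grade i == p]|
    = #|globals gr L p n|.
Proof.
rewrite -(card_imset _ (@enum_val_inj _ (mem (global_gens L n)))).
apply: eq_card => x; apply/imsetP/idP => [[i]|].
  rewrite inE /= => ip ->; rewrite inE ip andbT.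
  by have := enum_valP i; rewrite inE.
rewrite inE => /andP[Lx xp]; have xG : x \in global_gens L n by rewrite inE.
exists (enum_rank_in xG x); last by rewrite enum_rankK_in.
by rewrite inE /= enum_rankK_in.
Qed.

(** The empty family generates the zero module, so minimality empties the basis. This turns a bound
    on the degrees of a complex into one on the sizes of its matrices. *)
Lemma zero_basis (M : pmod) m (gr : 'I_m -> grade) (b : forall i, M (gr i)) :
  pm_is_zero M -> is_basis b -> m = 0%N.
Proof.
move=> M0 [_ min]; apply/eqP; rewrite -[m]card_ord -cardsT cards_eq0 eq_sym.
apply/eqP/min => z; apply/eqP; rewrite eq_sym big_set0 -dimv_eq0.
by rewrite M0.
Qed.

Theorem theorem3p5 (F G : pmseq) (A A' : gmatrices) (N : nat) :
  is_complex F ->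
  (forall n, (N < n)%N -> pm_is_zero (F n)) ->
  represents A F ->
  order_compatible A ->
  multi_chunk N A A' ->
  represents A' G ->
  forall (n : nat) (p : grade), (delta p F n)%:Z = gamma p G n.
Proof.
move=> cF F0 [b [freeF basis_b graded_A bd_b]] order_A [s [D [ph1 _ A'E]]].
move=> [b' [freeG basis_b' _ _]] n p.
have exF k := fg_free_lt_exact (freeF k).
have exG k := fg_free_lt_exact (freeG k).
have Minit := matrix_inv_init graded_A (fun k i j ij =>
  local_mx_complex basis_b graded_A bd_b cF ij erefl).
have m0 k : (N < k)%N -> gm_size A k = 0%N.
  by move=> /F0 Fk0; apply: zero_basis Fk0 (basis_b k).
have [Minv Linv L0] := phase1_inv m0 Minit ph1.
have -> : gamma p G n = #|[set i : 'I_(gm_size A' n) | gm_grade i == p]|%:Z.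
  rewrite /gamma (dim_gens_lt p (basis_b' n) (@exG n)) PoszD.
  ring.
rewrite A'E card_phase3; congr Posz.
(* The local ranks [r] and [r'] occur in both counts of the generators of grade [p] and cancel. *)
have arith (d r r' v ra a g : nat) :
  (d + r + r' = v - ra -> v = ra + a -> g + r' + r = a -> d = g)%N by lia.
apply: arith (delta_rank cF exF (dim_rad_boundaries basis_b graded_A bd_b p) n) _ _.
  exact: dim_gens (basis_b n) p.
exact: (card_globals Minv Linv order_A p n L0).
Qed.
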